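(* Given a unit disk graph $G=(V,E)$ with $n=|V|$ and any $\epsilon>0$, the minimum liar's vertex-edge dominating set of $G$ can be approximated within a factor of $(1+\epsilon)$ by an algorithm with running time $n^{O(c^2)}$, where $c=O\left(\frac{1}{\epsilon}\log\frac{1}{\epsilon}\right)$. That is, for every $\epsilon>0$ there is an algorithm which, given a unit disk graph $G$ on $n$ vertices, outputs within time $n^{O(c^2)}$ a liar's vertex-edge dominating set of $G$ of size at most $(1+\epsilon)$ times the minimum size of a liar's vertex-edge dominating set of $G$, where $c=c(\epsilon)$ depends only on $\epsilon$ and $c(\epsilon)=O\left(\frac{1}{\epsilon}\log\frac{1}{\epsilon}\right)$ (as $\epsilon\to 0^+$).
   Context: All graphs are finite, simple and undirected. For a graph $G=(V,E)$ and $v\in V$, $N_G(v)=\{u\in V: uv\in E\}$ and $N_G[v]=N_G(v)\cup\{v\}$; for an edge $e=xy\in E$, $N_G[e]=N_G[x]\cup N_G[y]$. A set $L\subseteq V$ is a liar's vertex-edge dominating set of $G$ if (i) $|N_G[e]\cap L|\geq 2$ for every $e\in E$, and (ii) $|(N_G[e]\cup N_G[e'])\cap L|\geq 3$ for every pair of distinct edges $e,e'\in E$. A unit disk graph is the intersection graph of disks of equal radii in the plane: there are centres $c_1,\dots,c_n$ of disks of diameter $1$, one vertex $v_i$ for each disk, and two distinct vertices are adjacent if and only if the corresponding disks intersect, i.e. the distance between their centres is at most $1$. *)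

(* Defs.v *)
From mathcomp Require Import all_boot all_order all_algebra.
From mathcomp Require Import ring lra.
Set Implicit Arguments.
Unset Strict Implicit.
Unset Printing Implicit Defensive.
Import Order.TTheory GRing.Theory Num.Theory.

Record graph (n : nat) := Graph {
  adj :> rel 'I_n;
  adj_sym : symmetric adj;
  adj_irr : irreflexive adj }.

Section LiarDomination.
Variables (n : nat) (G : graph n).
Local Open Scope nat_scope.

Definition edges : {set {set 'I_n}} :=
  [set [set p.1; p.2] | p : 'I_n * 'I_n & G p.1 p.2].

Definition nbhd (v : 'I_n) : {set 'I_n} := [set u | G v u].

Definition cl_nbhd (v : 'I_n) : {set 'I_n} := v |: nbhd v.

Definition edge_nbhd (e : {set 'I_n}) : {set 'I_n} :=
  \bigcup_(v in e) cl_nbhd v.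

Definition liar_ve_dominating (L : {set 'I_n}) : bool :=
  [forall e in edges, 2 <= #|edge_nbhd e :&: L|] &&
  [forall e in edges, forall e' in edges,
     (e != e') ==> (3 <= #|(edge_nbhd e :|: edge_nbhd e') :&: L|)].

Lemma edge_card (e : {set 'I_n}) : e \in edges -> #|e| = 2.
Proof.
case/imsetP=> -[x y]; rewrite inE /= => xy ->; rewrite cards2.
by case: eqVneq xy => // ->; rewrite adj_irr.
Qed.

Lemma sub_edge_nbhd (e : {set 'I_n}) : e \subset edge_nbhd e.
Proof. by apply/subsetP=> v ve; apply/bigcupP; exists v; rewrite // !inE eqxx. Qed.

Lemma liar_setT : liar_ve_dominating setT.
Proof.
apply/andP; split; apply/forallP=> e; apply/implyP=> eE; rewrite ?setIT.
  by rewrite -(edge_card eE) subset_leq_card // sub_edge_nbhd.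
apply/forallP=> e'; apply/implyP=> e'E; apply/implyP=> ne; rewrite setIT.
apply: leq_trans (subset_leq_card (setUSS (sub_edge_nbhd e) (sub_edge_nbhd e'))).
rewrite -{1}(edge_card eE); apply: proper_card; rewrite properE subsetUl /=.
apply: contra ne => /subUsetP[_ sub].
by rewrite eq_sym eqEcard sub (edge_card eE) (edge_card e'E).
Qed.

(* A minimum one exists because [setT] is a candidate (liar_setT). *)
Definition min_liar_size : nat :=
  #|[arg min_(L < setT | liar_ve_dominating L) #|L| ]|.

Lemma min_liar_sizeP :
  (exists2 L, liar_ve_dominating L & #|L| = min_liar_size) /\
  (forall L, liar_ve_dominating L -> min_liar_size <= #|L|).
Proof.
rewrite /min_liar_size; case: arg_minnP => [|L LL minL]; first exact: liar_setT.
by split=> //; exists L.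
Qed.

End LiarDomination.

From mathcomp Require Import all_classical all_reals all_analysis.

Section UnitDisk.
Variable R : realType.
Local Open Scope classical_set_scope.
Local Open Scope ring_scope.

(* Written out because the library's norm on products and matrices is the
   sup norm. *)
Definition edist (p q : R * R) : R :=
  Num.sqrt ((p.1 - q.1) ^+ 2 + (p.2 - q.2) ^+ 2).

(* closed disk of diameter 1 *)
Definition unit_disk (p : R * R) : set (R * R) := [set x | edist p x <= 2^-1].

Definition unit_disk_graph n (G : graph n) : Prop :=
  exists ctr : 'I_n -> R * R, forall i j : 'I_n, i != j ->
    (G i j <-> unit_disk (ctr i) `&` unit_disk (ctr j) !=set0).

Lemma edist_le p q (r : R) : 0 <= r ->
  (edist p q <= r) = ((p.1 - q.1) ^+ 2 + (p.2 - q.2) ^+ 2 <= r ^+ 2).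
Proof.
move=> r0; have rE : r = Num.sqrt (r ^+ 2) by rewrite sqrtr_sqr ger0_norm.
by rewrite /edist {1}rE ler_psqrt // nnegrE ?addr_ge0 ?sqr_ge0.
Qed.

Lemma unit_disk_meet (p q : R * R) :
  (unit_disk p `&` unit_disk q !=set0) <-> edist p q <= 1.
Proof.
have h0 : (0 : R) <= 2^-1 by rewrite invr_ge0.
split=> [[x []]|]; rewrite /unit_disk /= ?edist_le //.
  move: p q x => [a b] [c d] [x y] /= h1 h2.
  have := sqr_ge0 (a + c - 2 * x); have := sqr_ge0 (b + d - 2 * y); nra.
move: p q => [a b] [c d] /= h.
by exists ((a + c) / 2, (b + d) / 2); split; rewrite /= edist_le //=; nra.
Qed.

End UnitDisk.

(* Random-access machine.  The machine has registers r_0, r_1, ... and an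
   indirectly addressed memory, both holding natural numbers and initially
   zero; the input graph is read through the number of vertices and through
   single entries of its adjacency matrix, and never through a representation
   by disks.  Every operation takes one unit of time.  The arithmetic is
   addition and truncated subtraction only: without multiplication, unit cost
   is polynomially equivalent to Turing machine time. *)
Inductive expr :=
  | Cst of nat
  | Reg of nat
  | Mem of expr
  | GraphOrder
  | Adj of expr & expr
  | Add of expr & expr
  | Sub of expr & expr.

Inductive prog :=
  | Skip
  | SetReg of nat & expr
  | SetMem of expr & expr
  | Seq of prog & prog
  | If of expr & prog & prog
  | While of expr & prog.

Record state := State { regs : nat -> nat; memory : nat -> nat }.

Definition init_state : state := State (fun=> 0) (fun=> 0).

Definition upd (f : nat -> nat) (k v : nat) : nat -> nat :=
  fun i => if i == k then v else f i.

Section Semantics.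
Variables (n : nat) (G : graph n).
Local Open Scope nat_scope.

(* Out-of-range queries answer 0. *)
Definition adj_query (i j : nat) : nat :=
  if (insub i : option 'I_n, insub j : option 'I_n) is (Some u, Some v)
  then G u v else 0.

Fixpoint eval (s : state) (e : expr) : nat :=
  match e with
  | Cst k => k
  | Reg k => regs s k
  | Mem a => memory s (eval s a)
  | GraphOrder => n
  | Adj a b => adj_query (eval s a) (eval s b)
  | Add a b => eval s a + eval s b
  | Sub a b => eval s a - eval s b
  end.

Fixpoint cost (e : expr) : nat :=
  match e with
  | Cst _ | Reg _ | GraphOrder => 1
  | Mem a => (cost a).+1
  | Adj a b | Add a b | Sub a b => (cost a + cost b).+1
  end.

(* [exec p s t s']: started in state s, p halts after t steps in state s'.
   Tests succeed on nonzero values. *)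
Inductive exec : prog -> state -> nat -> state -> Prop :=
  | ExecSkip s : exec Skip s 1 s
  | ExecSetReg s k e :
      exec (SetReg k e) s (cost e).+1
           (State (upd (regs s) k (eval s e)) (memory s))
  | ExecSetMem s a e :
      exec (SetMem a e) s (cost a + cost e).+1
           (State (regs s) (upd (memory s) (eval s a) (eval s e)))
  | ExecSeq p q s t s' t' s'' :
      exec p s t s' -> exec q s' t' s'' -> exec (Seq p q) s (t + t') s''
  | ExecIfTrue e p q s t s' :
      eval s e != 0 -> exec p s t s' -> exec (If e p q) s (cost e + t).+1 s'
  | ExecIfFalse e p q s t s' :
      eval s e = 0 -> exec q s t s' -> exec (If e p q) s (cost e + t).+1 s'
  | ExecWhileTrue e p s t s' t' s'' :
      eval s e != 0 -> exec p s t s' -> exec (While e p) s' t' s'' ->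
      exec (While e p) s (cost e + t + t').+1 s''
  | ExecWhileFalse e p s :
      eval s e = 0 -> exec (While e p) s (cost e).+1 s.

(* The memory cells 0, ..., n-1 hold the characteristic vector of the
   output. *)
Definition output (s : state) : {set 'I_n} := [set i : 'I_n | memory s i != 0].

Lemma exec_det p s t s' : exec p s t s' ->
  forall t2 s2, exec p s t2 s2 -> t2 = t /\ s2 = s'.
Proof.
elim=> {p s t s'} [s|s k e|s a e|p q s t s' t' s'' _ IHp _ IHq
  |e p q s t s' se _ IH|e p q s t s' se _ IH
  |e p s t s' t' s'' se _ IHp _ IHw|e p s se] t2 s2 H; inversion H; subst => //;
  repeat match goal with
  | IH : forall t s, exec ?p ?s0 t s -> _, E : exec ?p ?s0 _ _ |- _ =>
      have [? ?] := IH _ _ E; clear E; subst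
  | N : is_true (eval ?s ?e != 0), Z : eval ?s ?e = 0 |- _ =>
      by rewrite Z in N
  end; by [].
Qed.

Definition runs_to (p : prog) (t : nat) (L : {set 'I_n}) : Prop :=
  exists2 s, exec p init_state t s & output s = L.

End Semantics.

(* Main.v *)
(* Call a vertex u satisfied by L when the liar's conditions hold for all edges
   at u; this is monotone in L, only depends on L within distance 5 of u, and L
   is liar's dominating iff it satisfies every vertex. Let opt(r) be the least
   number of vertices satisfying the uncovered vertices of the ball of radius r
   around an uncovered vertex v. Choosing three vertices in each cell of a grid
   of mesh 1/2 shows opt(r) = O(r^2), so that opt(10(j+1)) <= (1+eps) opt(10j)
   for some j = O(1/eps log 1/eps). The algorithm finds such a j and an optimal
   set for the larger ball by exhaustive search, outputs this set, marks the
   larger ball as covered and goes on with the next uncovered vertex. The part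
   of an optimum L* within distance 5 of the uncovered vertices of the smaller
   ball satisfies them, hence pays for the set just output, and the parts of L*
   used in different rounds are disjoint. *)
Require Import Defs.
From mathcomp Require Import all_boot all_order all_algebra.
From mathcomp Require Import zify ring lra.
From mathcomp Require boolp.
Import Defs.
Import Order.TTheory GRing.Theory Num.Theory.
Set Implicit Arguments.
Unset Strict Implicit.
Unset Printing Implicit Defensive.

Local Open Scope nat_scope.

(** * Search programs *)

(* Register 0 receives the truth value of a test: 0 for false and n+1 for true,
   so that the loop guard of [ex_prog], the truncated difference between the
   search register and register 0, also vanishes at the first success. *)
Definition tt_prog := SetReg 0 (Add GraphOrder (Cst 1)).
Definition ff_prog := SetReg 0 (Cst 0).
Definition test_prog e := If e tt_prog ff_prog.
Definition cond_prog p q r := Seq p (If (Reg 0) q r).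
Definition not_prog p := cond_prog p ff_prog tt_prog.
Definition and_prog p q := cond_prog p q ff_prog.
Definition imp_prog p q := cond_prog p q tt_prog.
Definition or_prog p q := cond_prog p tt_prog q.

(* On success the registers d, d+1, ... bound by nested searches still hold
   the witnesses. *)
Definition ex_prog d p :=
  Seq ff_prog (Seq (SetReg d GraphOrder)
    (While (Sub (Reg d) (Reg 0)) (Seq (SetReg d (Sub (Reg d) (Cst 1))) p))).

Definition forall_prog d p := not_prog (ex_prog d (not_prog p)).

Fixpoint exs_prog k d p :=
  if k is k'.+1 then ex_prog d (exs_prog k' d.+1 p) else p.

Definition any_prog := foldr or_prog ff_prog.
Definition all_prog := foldr and_prog tt_prog.

(** Boolean logic by arithmetic: nonzero is true, addition is disjunction, and truncated subtraction
    from 1 is negation. *)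
Definition test_eq i j :=
  Sub (Cst 1) (Add (Sub (Reg i) (Reg j)) (Sub (Reg j) (Reg i))).
Definition test_cl i j := Add (test_eq i j) (Adj (Reg i) (Reg j)).
Definition test_not a := Sub (Cst 1) a.
Definition test_and a b := test_not (Add (test_not a) (test_not b)).
Definition test_any := foldr Add (Cst 0).
Definition test_mem i js := test_any [seq test_eq i j | j <- js].
Fixpoint test_uniq js :=
  if js is i :: js' then test_and (test_not (test_mem i js')) (test_uniq js')
  else Cst 1.
Fixpoint test_all es :=
  if es is e :: es' then test_and e (test_all es') else Cst 1.

(** * Program rules with time bounds *)

Section Running.
Variables (n : nat) (G : graph n).
Implicit Types (d w : nat) (f m : nat -> nat) (p q r : prog) (s : state).

Let N := maxn n 2.

(* Registers 1, ..., d-1 are the variables in scope, with values f; m is the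
   memory at the start. Bounding times by powers of [maxn n 2] lets exponents
   absorb constant factors, also for n < 2. *)
Definition runs d f m p w (Q : bool -> (nat -> nat) -> Prop) :=
  forall s, (forall i, 0 < i < d -> regs s i = f i) -> memory s = m ->
  exists t s', [/\ exec G p s t s', t <= N ^ w,
    forall i, 0 < i < d -> regs s' i = f i
    & exists2 b : bool, regs s' 0 = (if b then n.+1 else 0) & Q b (memory s')].

Definition decides d f m p w (B : Prop) :=
  runs d f m p w (fun b m' => (b <-> B) /\ m' = m).

Let N_gt1 : 1 < N. Proof. exact: leq_maxr. Qed.
Let N_gt0 : 0 < N. Proof. exact: ltnW. Qed.
Let n_leN : n <= N. Proof. exact: leq_maxl. Qed.

Lemma expN_gt0 w : 0 < N ^ w. Proof. by rewrite expn_gt0 N_gt0. Qed.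

Lemma leq_expN w w' : w <= w' -> N ^ w <= N ^ w'.
Proof. exact: leq_pexp2l. Qed.

Lemma expN_mul2 k w : 2 ^ k * N ^ w <= N ^ (w + k).
Proof.
by rewrite mulnC expnD leq_mul2l; apply/orP; right; case: k => // k; rewrite leq_exp2r.
Qed.

Lemma runs_weaken d f m p w w' (Q Q' : bool -> (nat -> nat) -> Prop) :
  w <= w' -> (forall b m', Q b m' -> Q' b m') ->
  runs d f m p w Q -> runs d f m p w' Q'.
Proof.
move=> ww QQ H s sf sm; have [t [s' [E tw rs' [b b0 Qb]]]] := H s sf sm.
exists t, s'; split=> //; first exact: leq_trans tw (leq_expN ww).
by exists b => //; apply: QQ.
Qed.

Lemma decides_weaken d f m p w w' (B B' : Prop) :
  w <= w' -> (B <-> B') -> decides d f m p w B -> decides d f m p w' B'.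
Proof.
by move=> ww BB; apply: runs_weaken => // b m' [bB ->]; split=> //; rewrite bB.
Qed.

Lemma runs_tt d f m : runs d f m tt_prog 2 (fun b m' => b /\ m' = m).
Proof.
move=> s sf sm; exists 4, (State (upd (regs s) 0 (n + 1)) (memory s)); split.
- exact: ExecSetReg.
- by rewrite (_ : 4 = 2 ^ 2) // leq_exp2r.
- by move=> [] // i id; rewrite /= /upd /= sf.
- by exists true => //=; rewrite /upd /= addn1.
Qed.

Lemma runs_ff d f m : runs d f m ff_prog 2 (fun b m' => ~~ b /\ m' = m).
Proof.
move=> s sf sm; exists 2, (State (upd (regs s) 0 0) (memory s)); split.
- exact: ExecSetReg.
- by apply: leq_trans (_ : 4 <= _) => //; rewrite (_ : 4 = 2 ^ 2) // leq_exp2r.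
- by move=> [] // i id; rewrite /= /upd /= sf.
- by exists false.
Qed.

Lemma decides_test d f m e (B : bool) :
  (forall s, (forall i, 0 < i < d -> regs s i = f i) -> memory s = m ->
    (eval G s e != 0) = B) ->
  decides d f m (test_prog e) (cost e + 3) B.
Proof.
move=> eB s sf sm; have := eB s sf sm.
have ce : cost e < N ^ cost e by apply: ltn_expl.
have le5 t : t <= 4 -> (cost e + t).+1 <= N ^ (cost e + 3).
  move=> t4; apply: leq_trans (expN_mul2 _ _); lia.
case: B {eB} => e0.
  have [t [s' [E tw rs' [b b0 Qb]]]] := @runs_tt d f m s sf sm.
  inversion E; subst.
  eexists; eexists; split; [apply: ExecIfTrue E; rewrite e0 // | exact: le5 | done|].
  by exists b => //; case: Qb.
have [t [s' [E tw rs' [b b0 Qb]]]] := @runs_ff d f m s sf sm.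
inversion E; subst.
eexists; eexists; split; [apply: ExecIfFalse E; exact/eqP/negbFE | exact: le5 | done|].
by exists b => //; case: Qb => /negbTE-> ->.
Qed.

Lemma runs_seq d f m p q w w' (Q Q' : bool -> (nat -> nat) -> Prop) :
  runs d f m p w Q ->
  (forall b m', Q b m' -> runs d f m' q w' Q') ->
  runs d f m (Seq p q) (maxn w w').+1 Q'.
Proof.
move=> Hp Hq s sf sm; have [t [s1 [E tw rs1 [b b0 Qb]]]] := Hp s sf sm.
have [t' [s2 [E' tw' rs2 Qb']]] := Hq b _ Qb s1 rs1 erefl.
exists (t + t'), s2; split=> //; first exact: ExecSeq E E'.
rewrite -addn1; apply: leq_trans (expN_mul2 _ _).
have := leq_expN (leq_maxl w w'); have := leq_expN (leq_maxr w w'); lia.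
Qed.

Lemma runs_cond d f m p q r w w' (Q Q' : bool -> (nat -> nat) -> Prop) :
  runs d f m p w Q ->
  (forall m', Q true m' -> runs d f m' q w' Q') ->
  (forall m', Q false m' -> runs d f m' r w' Q') ->
  runs d f m (cond_prog p q r) (maxn w w').+2 Q'.
Proof.
move=> Hp Hq Hr s sf sm; have [t [s1 [E tw rs1 [b b0 Qb]]]] := Hp s sf sm.
have le t' : t' <= N ^ w' -> t + (1 + t').+1 <= N ^ (maxn w w').+2.
  move=> ?; rewrite -addn2; apply: leq_trans (expN_mul2 _ _).
  have := leq_expN (leq_maxl w w'); have := leq_expN (leq_maxr w w').
  have := expN_gt0 (maxn w w'); lia.
case: b b0 Qb => b0 Qb.
  have [t' [s2 [E' tw' rs2 Qb']]] := Hq _ Qb s1 rs1 erefl.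
  exists (t + (1 + t').+1), s2; split=> //; last exact: le.
  by apply: ExecSeq E _; apply: ExecIfTrue => //=; rewrite b0.
have [t' [s2 [E' tw' rs2 Qb']]] := Hr _ Qb s1 rs1 erefl.
exists (t + (1 + t').+1), s2; split=> //; last exact: le.
by apply: ExecSeq E _; apply: ExecIfFalse.
Qed.

Lemma runs_store d f m a k :
  (forall s, (forall i, 0 < i < d -> regs s i = f i) -> memory s = m ->
    eval G s a = k) ->
  runs d f m (Seq (SetMem a (Cst 1)) tt_prog) (cost a + 3)
    (fun b m' => m' = upd m k 1).
Proof.
move=> ak s sf sm; set s1 := State (regs s) (upd (memory s) k 1).
have [t [s' [E tw rs' [b b0 [_ Qb]]]]] :=
  @runs_tt d f (upd m k 1) s1 sf (congr1 (fun g => upd g k 1) sm).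
inversion E; subst.
eexists; eexists; split; [apply: ExecSeq _ E | | done|].
- by rewrite /s1 -(ak s sf erefl); apply: ExecSetMem.
- have ce : cost a < N ^ cost a by apply: ltn_expl.
  by apply: leq_trans (expN_mul2 _ _) => /=; lia.
- by exists b.
Qed.

(** Loop rule. The search counts down from [n], so [I k] is the state of the memory once all
    candidates [i >= k] have been tried and failed, and [T] holds at the first success. Since the
    body may change the memory even when it fails, the rule also covers loops run only for their
    effect. *)
Lemma runs_ex d f m p w (I : nat -> (nat -> nat) -> Prop)
    (T : (nat -> nat) -> Prop) :
  0 < d -> I n m ->
  (forall (i : 'I_n) m', I i.+1 m' ->
    runs d.+1 (upd f d i) m' p w (fun b m'' => if b then T m'' else I i m'')) ->
  runs d f m (ex_prog d p) (w + 6) (fun b m' => if b then T m' else I 0 m').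
Proof.
move=> d0 In step.
have loop k s : k <= n -> (forall i, 0 < i < d -> regs s i = f i) ->
    regs s 0 = 0 -> regs s d = k -> I k (memory s) ->
    exists t s', [/\ exec G (While (Sub (Reg d) (Reg 0))
        (Seq (SetReg d (Sub (Reg d) (Cst 1))) p)) s t s',
      t <= 4 + k * (8 + N ^ w), forall i, 0 < i < d -> regs s' i = f i &
      exists2 b : bool, regs s' 0 = (if b then n.+1 else 0) &
        if b then T (memory s') else I 0 (memory s')].
  elim: k s => [|k IH] s kn sf s0 sd Is.
    exists 4, s; split=> //; last by exists false.
    by apply: ExecWhileFalse; rewrite /= s0 sd.
  set s1 := State (upd (regs s) d k) (memory s).
  have E1 : exec G (SetReg d (Sub (Reg d) (Cst 1))) s 4 s1.
    by have := ExecSetReg G s d (Sub (Reg d) (Cst 1)); rewrite /= sd subn1.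
  have [|t [s2 [E2 t2 r2 [b b0 Qb]]]] := step (Ordinal kn) (memory s) Is s1 _ erefl.
    move=> i /andP[i0]; rewrite ltnS leq_eqVlt /= /upd => /orP[/eqP->|id].
      by rewrite eqxx.
    by case: eqVneq => [//|_]; rewrite sf ?i0.
  have r2f i : 0 < i < d -> regs s2 i = f i.
    move=> /andP[i0 id]; rewrite r2 ?i0 ?ltnS 1?ltnW // /upd.
    by case: eqVneq id => // ->; rewrite ltnn.
  have r2d : regs s2 d = k by rewrite r2 ?d0 ?ltnS ?leqnn // /upd eqxx.
  have g0 : eval G s (Sub (Reg d) (Reg 0)) != 0 by rewrite /= s0 sd.
  case: b b0 Qb => b0 Qb.
    exists (3 + (4 + t) + 4).+1, s2; split=> //.
    - apply: ExecWhileTrue g0 (ExecSeq E1 E2) _.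
      by apply: ExecWhileFalse; rewrite /= b0 r2d; apply/eqP; rewrite subn_eq0 ltnW // ltnW.
    - by rewrite mulSn; move: t2; lia.
    - by exists true.
  have [t3 [s3 [E3 t3w r3 Q3]]] := IH s2 (ltnW kn) r2f b0 r2d Qb.
  exists (3 + (4 + t) + t3).+1, s3; split=> //.
  - exact: ExecWhileTrue g0 (ExecSeq E1 E2) E3.
  - by rewrite mulSn; move: t2 t3w; lia.
move=> s sf sm.
set s1 := State (upd (regs s) 0 0) (memory s).
set s2 := State (upd (upd (regs s) 0 0) d n) (memory s).
have dn0 : (d == 0) = false by rewrite eqn0Ngt d0.
have [|||||t [s' [E tw rs' Qb]]] // := loop n s2.
- move=> [|i] //= id; rewrite /upd /=; case: eqVneq => [ed|_]; first by rewrite ed ltnn in id.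
  by rewrite sf.
- by rewrite /= /upd [0 == d]eq_sym dn0.
- by rewrite /= /upd eqxx.
- by rewrite /= sm.
exists (2 + (2 + t)), s'; split=> //.
  apply: ExecSeq (ExecSetReg G s 0 (Cst 0)) _.
  exact: ExecSeq (ExecSetReg G s1 d GraphOrder) E.
(* One factor [N] pays for the [n] rounds, and [N ^ 5 >= 32] for the constant overhead of each
   round. *)
have -> : N ^ (w + 6) = N ^ w * N ^ 5 * N by rewrite -mulnA -expnSr expnD.
have a1 : 2 ^ 5 <= N ^ 5 by rewrite leq_exp2r.
have a2 := expN_gt0 w; move: tw n_leN N_gt1 a1 a2.
move: (N ^ w) (N ^ 5) => x y tw nN N1 a1 a2.
have b1 : 32 * x <= x * y by rewrite [32 * x]mulnC leq_mul2l a1 orbT.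
have b2 : n * (8 + x) <= N * (8 + x) by rewrite leq_mul2r nN orbT.
have b3 : 32 * x * N <= x * y * N by rewrite leq_mul2r b1 orbT.
have b4 : 1 * N <= x * N by rewrite leq_mul2r a2 orbT.
by move: tw b2 b3 b4; rewrite !mulnDr -(mulnA 32); lia.
Qed.

Lemma decides_tt d f m : decides d f m tt_prog 2 True.
Proof. by apply: runs_weaken (@runs_tt d f m) => // b m' [-> ->]. Qed.

Lemma decides_not d f m p w B :
  decides d f m p w B -> decides d f m (not_prog p) (maxn w 2).+2 (~ B).
Proof.
move=> H; apply: (runs_cond H) => m' [bB ->].
  apply: runs_weaken (@runs_ff d f m) => // b _ [/negbTE-> ->].
  by split=> //; split=> // /(_ (proj1 bB erefl)).
by apply: runs_weaken (@runs_tt d f m) => // b _ [-> ->]; split=> //; split=> // _ /bB.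
Qed.

Lemma decides_and d f m p q w w' (B C : Prop) :
  decides d f m p w B -> (B -> decides d f m q w' C) ->
  decides d f m (and_prog p q) (maxn w (maxn w' 2)).+2 (B /\ C).
Proof.
move=> Hp Hq; apply: (runs_cond Hp) => m' [bB ->].
  have b := proj1 bB erefl.
  by apply: runs_weaken (Hq b) => [|b' _ [bC ->]]; [exact: leq_maxl|split=> //; tauto].
apply: runs_weaken (@runs_ff d f m) => [|b _ [/negbTE-> ->]]; first exact: leq_maxr.
by split=> //; split=> // -[/bB].
Qed.

Lemma decides_ex d f m p w (B : 'I_n -> Prop) :
  0 < d -> (forall i : 'I_n, decides d.+1 (upd f d i) m p w (B i)) ->
  decides d f m (ex_prog d p) (w + 6) (exists i, B i).
Proof.
move=> d0 H.
pose I k m' := m' = m /\ forall i : 'I_n, k <= i -> ~ B i.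
pose T m' := m' = m /\ exists i, B i.
have In : I n m by split=> // i; rewrite leqNgt ltn_ord.
apply: runs_weaken (@runs_ex d f m p w I T d0 In _) => //.
  move=> [] m' [-> HB]; split=> //.
  by split=> // -[i] /HB; case.
move=> i _ [-> HB]; apply: runs_weaken (H i) => // -[] _ [bB ->]; split=> //.
  by exists i; apply/bB.
move=> j; rewrite leq_eqVlt => /orP[/eqP/val_inj <- /bB //|]; exact: HB.
Qed.

(** A failing body must leave the memory as it was, so that every candidate is tried from [m]. A
    succeeding one may change it: the program commits its solution inside the search, while the
    registers holding it are in scope. *)
Lemma runs_exs k d f m p w (F : seq 'I_n -> Prop) (T : (nat -> nat) -> Prop) :
  0 < d ->
  (forall xs g, size xs = k -> (forall i, 0 < i < d -> g i = f i) ->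
    [seq g i | i <- iota d k] = [seq val x | x <- xs] ->
    runs (d + k) g m p w (fun b m' => if b then T m' else m' = m /\ F xs)) ->
  runs d f m (exs_prog k d p) (w + k * 6)
    (fun b m' => if b then T m' else m' = m /\ forall xs, size xs = k -> F xs).
Proof.
elim: k d f F => [|k IH] d f F d0 H /=.
  have := H [::] f erefl (fun _ _ => erefl) erefl; rewrite addn0 => H0.
  by apply: runs_weaken H0 => [|[] m' // [-> FF]]; [lia | split=> // -[]].
pose I (k0 : nat) m' := m' = m /\
  forall (x : 'I_n) xs, k0 <= x -> size xs = k -> F (x :: xs).
have In : I n m by split=> // x xs; rewrite leqNgt ltn_ord.
apply: runs_weaken (@runs_ex d f m (exs_prog k d.+1 p) (w + k * 6) I T d0 In _).
- lia.
- move=> [] // m' [-> HF]; split=> // -[//|x xs] [sx]; exact: HF.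
move=> i _ [-> HI].
apply: runs_weaken (IH d.+1 (upd f d i) (fun xs => F (i :: xs)) _ _) => //.
- move=> [] // m' [-> HF]; split=> // x xs.
  rewrite leq_eqVlt => /orP[/eqP/val_inj <- sx|]; [exact: HF|exact: HI].
- move=> xs g sx gf gxs; rewrite addSnnS; apply: H => /=; first by rewrite sx.
    move=> j /andP[j0 jd]; rewrite gf ?j0 ?ltnS 1?ltnW // /upd.
    by case: eqVneq jd => // ->; rewrite ltnn.
  by rewrite gxs gf ?d0 ?ltnS ?leqnn // /upd eqxx.
Qed.

Lemma decides_exs k d f m p w (B : seq 'I_n -> Prop) :
  0 < d ->
  (forall xs g, size xs = k -> (forall i, 0 < i < d -> g i = f i) ->
    [seq g i | i <- iota d k] = [seq val x | x <- xs] ->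
    decides (d + k) g m p w (B xs)) ->
  decides d f m (exs_prog k d p) (w + k * 6) (exists2 xs, size xs = k & B xs).
Proof.
move=> d0 H.
apply: runs_weaken (@runs_exs k d f m p w (fun xs => ~ B xs)
  (fun m' => m' = m /\ exists2 xs, size xs = k & B xs) d0 _) => //.
  by move=> [] m' [-> HB]; split=> //; split=> // -[xs /HB].
move=> xs g sx gf gxs; apply: runs_weaken (H xs g sx gf gxs) => // -[] m' [bB ->].
  by split=> //; exists xs => //; apply/bB.
by split=> // /bB.
Qed.

Lemma decides_all d f m (I : eqType) (l : seq I) (P : I -> prog)
    (B : I -> Prop) w :
  (forall i, i \in l -> decides d f m (P i) w (B i)) ->
  decides d f m (all_prog [seq P i | i <- l]) (maxn w 2 + size l * 2)
    (forall i, i \in l -> B i).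
Proof.
elim: l => [|i l IH] H /=.
  by apply: decides_weaken (@decides_tt d f m) => //; rewrite addn0 leq_maxr.
have Hi := H i (mem_head i l).
have Hl := IH (fun j jl => H j (mem_behead (s := i :: l) jl)).
apply: decides_weaken (decides_and Hi (fun=> Hl)); first lia.
split=> [[Bi Bl] j|Bl]; first by rewrite inE => /orP[/eqP->|/Bl].
by split=> [|j jl]; apply: Bl; rewrite inE ?eqxx // jl orbT.
Qed.

Lemma runs_any d f m (I : eqType) (l : seq I) (P : I -> prog) w (F : I -> Prop)
    (T : (nat -> nat) -> Prop) :
  (forall i, i \in l ->
    runs d f m (P i) w (fun b m' => if b then T m' else m' = m /\ F i)) ->
  runs d f m (any_prog [seq P i | i <- l]) (maxn w 2 + size l * 2)
    (fun b m' => if b then T m' else m' = m /\ forall i, i \in l -> F i).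
Proof.
elim: l => [|i l IH] H /=.
  by apply: runs_weaken (@runs_ff d f m) => [|b _ [/negbTE-> ->] //]; rewrite addn0 leq_maxr.
have Hi := H i (mem_head i l).
have Hl := IH (fun j jl => H j (mem_behead (s := i :: l) jl)).
apply: runs_weaken (runs_cond Hi (w' := maxn w 2 + size l * 2) _ _).
- lia.
- move=> b m'; exact.
- move=> m' Tm; apply: runs_weaken (@runs_tt d f m') => [|b _ [-> ->] //]; lia.
move=> _ [-> Fi]; apply: runs_weaken Hl => // -[] // m' [-> Fl].
by split=> // j; rewrite inE => /orP[/eqP->|/Fl].
Qed.

Lemma decides_imp d f m p q w w' (B C : Prop) :
  decides d f m p w B -> (B -> decides d f m q w' C) ->
  decides d f m (imp_prog p q) (maxn w (maxn w' 2)).+2 (B -> C).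
Proof.
move=> Hp Hq; apply: (runs_cond Hp) => m' [bB ->].
  have b := proj1 bB erefl.
  by apply: runs_weaken (Hq b) => [|b' _ [bC ->]]; [exact: leq_maxl|split=> //; tauto].
apply: runs_weaken (@runs_tt d f m) => [|b _ [-> ->]]; first exact: leq_maxr.
by split=> //; split=> // _ /bB.
Qed.

Lemma decides_forall d f m p w (B : 'I_n -> Prop) :
  0 < d -> (forall i : 'I_n, decides d.+1 (upd f d i) m p w (B i)) ->
  decides d f m (forall_prog d p) (maxn w 2 + 10) (forall i, B i).
Proof.
move=> d0 H; have := decides_not (decides_ex d0 (fun i => decides_not (H i))).
apply: decides_weaken; first lia.
split=> [nex i|BB [i]]; last by apply.
by apply: boolp.contrapT => nB; apply: nex; exists i.
Qed.

End Running.

(** * Liar's domination as a local condition *)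

Section Neighbourhoods.
Variables (n : nat) (G : graph n).
Implicit Types (u v w x y z : 'I_n) (X Y L : {set 'I_n}).

(** Steps go through closed neighbourhoods, so a walk may pause, and walks of exactly [r] steps
    express distance at most [r]. *)
Fixpoint dist_le r u v : bool :=
  if r is r'.+1 then [exists w, (w \in cl_nbhd G u) && dist_le r' w v] else u == v.

Lemma in_cl_nbhd u w : (w \in cl_nbhd G u) = (u == w) || G u w.
Proof. by rewrite !inE eq_sym. Qed.

Lemma cl_nbhd_sym u w : (w \in cl_nbhd G u) = (u \in cl_nbhd G w).
Proof. by rewrite !in_cl_nbhd eq_sym adj_sym. Qed.

Lemma dist_le_refl r u : dist_le r u u.
Proof.
elim: r => [|r IH] /=; first exact: eqxx.
by apply/existsP; exists u; rewrite in_cl_nbhd eqxx.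
Qed.

Lemma dist_le_trans a b u v w : dist_le a u v -> dist_le b v w -> dist_le (a + b) u w.
Proof.
elim: a u => [|a IH] u /=; first by move/eqP->.
case/existsP=> x /andP[ux xv] vw; apply/existsP; exists x; rewrite ux /=.
exact: IH.
Qed.

Lemma dist_le_leq a b u v : a <= b -> dist_le a u v -> dist_le b u v.
Proof. by move=> /subnKC <- uv; apply: dist_le_trans uv (dist_le_refl _ _). Qed.

Lemma dist_le1 u v : dist_le 1 u v = (v \in cl_nbhd G u).
Proof.
apply/existsP/idP => [[w /andP[uw /eqP <-]] //|uv]; by exists v; rewrite uv /= eqxx.
Qed.

Lemma dist_le_sym r u v : dist_le r u v -> dist_le r v u.
Proof.
elim: r u => [|r IH] u; first by rewrite /= eq_sym.
case/existsP=> x /andP[ux xv]; rewrite -addn1.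
by apply: dist_le_trans (IH _ xv) _; rewrite dist_le1 cl_nbhd_sym.
Qed.

Lemma dist_le_adj u v : G u v -> dist_le 1 u v.
Proof. by move=> uv; rewrite dist_le1 in_cl_nbhd uv orbT. Qed.

(** Listing endpoints turns a union of edge neighbourhoods into a concatenation, and membership into
    a disjunction over registers. *)
Definition hood (s : seq 'I_n) : {set 'I_n} :=
  [set z | has (fun h => z \in cl_nbhd G h) s].

Lemma in_hood s z : (z \in hood s) = has (fun h => z \in cl_nbhd G h) s.
Proof. exact: in_set. Qed.

(* The conditions involving the edges at u, the pairs (e, e') being restricted
   to those where e' has an endpoint at distance at most 3 from u: this covers
   all pairs with intersecting neighbourhoods, and for the others condition
   (ii) follows from (i). *)
Definition sat X u := forall w, G u w ->
  2 <= #|hood [:: u; w] :&: X| /\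
  forall x y, G x y -> dist_le 3 u x ->
    ~~ ((u == x) && (w == y) || (u == y) && (w == x)) ->
    3 <= #|hood [:: u; w; x; y] :&: X|.

Lemma edge_nbhd2 x y : edge_nbhd G [set x; y] = hood [:: x; y].
Proof.
apply/setP=> z; rewrite [RHS]inE /= orbF; apply/bigcupP/orP => [[v]|].
  by rewrite !inE => /orP[] /eqP-> ?; [left|right].
by case=> ?; [exists x|exists y]; rewrite // !inE eqxx ?orbT.
Qed.

Lemma hood_cat s t : hood (s ++ t) = hood s :|: hood t.
Proof. by apply/setP=> z; rewrite !inE has_cat. Qed.

Lemma mem_edges u w : G u w -> [set u; w] \in edges G.
Proof. by move=> uw; apply/imsetP; exists (u, w) => //; rewrite inE. Qed.

Lemma liar_sat L : liar_ve_dominating G L <-> forall u, sat L u.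
Proof.
split=> [/andP[/forallP Hi /forallP Hii] u w uw|H].
  have E := mem_edges uw; split.
    by have := Hi [set u; w]; rewrite E edge_nbhd2.
  move=> x y xy _ ne; have := Hii [set u; w]; rewrite E.
  move=> /forallP/(_ [set x; y]); rewrite mem_edges //= !edge_nbhd2 -hood_cat.
  move/implyP; apply; apply: contra ne => /eqP ee.
  have wu : w != u by apply: contraTneq uw => ->; rewrite adj_irr.
  have : u \in [set x; y] by rewrite -ee !inE eqxx.
  have : w \in [set x; y] by rewrite -ee !inE eqxx orbT.
  rewrite !inE ![w == _]eq_sym ![u == _]eq_sym.
  by case: (x =P u) (y =P u) (x =P w) (y =P w) => [->|_] [->|_] [xw|_] [yw|_] //=;
    move: wu; rewrite -?xw -?yw ?eqxx.
have H2 u w : G u w -> 2 <= #|hood [:: u; w] :&: L| by move=> /H[].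
apply/andP; split; apply/forallP=> e; apply/implyP=> /imsetP[[u w]]; rewrite inE /= => uw ->.
  by rewrite edge_nbhd2 H2.
apply/forallP=> e'; apply/implyP=> /imsetP[[x y]]; rewrite inE /= => xy ->.
apply/implyP=> ne; rewrite !edge_nbhd2.
have ne1 : ~~ ((u == x) && (w == y) || (u == y) && (w == x)).
  apply: contra ne => /orP[] /andP[/eqP-> /eqP->] //.
  by apply/eqP/setP=> z; rewrite !inE orbC.
have [ux|ux] := boolP (dist_le 3 u x).
  by rewrite -hood_cat; apply: (proj2 (H u w uw)).
(* [sat] measures the distance to the first endpoint, so an edge that is near [u] only through [y]
   is read in reverse. *)
have [uy|uy] := boolP (dist_le 3 u y).
  have -> : hood [:: u; w] :|: hood [:: x; y] = hood [:: u; w; y; x].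
    by rewrite -hood_cat; apply/setP=> z; rewrite !inE /= !orbF; do 2 congr (_ || _); rewrite orbC.
  by apply: (proj2 (H u w uw)); rewrite // ?(adj_sym G y) // orbC.
(* Now both [x] and [y] are at distance more than 3 from [u]. A common vertex of the two edge
   neighbourhoods would be within 2 of [u] and within 1 of [x] or [y], so they are disjoint and
   condition (i) yields 2 + 2 vertices. *)
rewrite setIUl cardsU.
suff -> : hood [:: u; w] :&: L :&: (hood [:: x; y] :&: L) = set0.
  by rewrite cards0 subn0; have := H2 _ _ uw; have := H2 _ _ xy; lia.
apply/eqP; rewrite -subset0; apply/subsetP=> z; rewrite !in_setI !in_hood /= !orbF.
case/andP=> /andP[uwz _] /andP[xyz _]; exfalso.
have {uwz} uz : dist_le 2 u z.
  case/orP: uwz; rewrite -dist_le1; first exact: dist_le_leq.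
  exact: dist_le_trans (dist_le_adj uw).
case/orP: xyz; rewrite -dist_le1 => /dist_le_sym zx.
  by rewrite (dist_le_trans uz zx) in ux.
by rewrite (dist_le_trans uz zx) in uy.
Qed.

(** The radius is 3 + 1 + 1: [x] is within 3 of [u], hence [y] within 4, and their neighbourhoods
    reach one step further. *)
Lemma sat_local X Y u :
  (forall z, dist_le 5 u z -> z \in X -> z \in Y) -> sat X u -> sat Y u.
Proof.
move=> XY H w uw; have [H2 H3] := H w uw.
have sub s : (forall h, h \in s -> dist_le 4 u h) -> hood s :&: X \subset hood s :&: Y.
  move=> sn; apply/subsetP=> z; rewrite !inE => /andP[zs zX]; rewrite zs /=.
  case/hasP: zs => h /sn uh hz; apply: XY zX.
  by apply: dist_le_trans uh _; rewrite dist_le1.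
have u1 : dist_le 4 u w by apply: dist_le_leq (dist_le_adj uw).
split=> [|x y xy ux ne].
  apply: leq_trans H2 (subset_leq_card (sub _ _)) => h.
  by rewrite !inE => /orP[]/eqP-> //; apply: dist_le_refl.
apply: leq_trans (H3 x y xy ux ne) (subset_leq_card (sub _ _)) => h.
rewrite !inE => /or4P[]/eqP-> //; first exact: dist_le_refl.
  exact: dist_le_leq ux.
exact: dist_le_trans ux (dist_le_adj xy).
Qed.

(** Keep the first three members of each class, in the order of enumeration. Classes are cliques, so
    a vertex that is not kept has the three kept members of its class as neighbours. A kept vertex
    is determined by its class and its rank, which gives the bound. *)
Lemma class_representatives (C : finType) (cell : 'I_n -> C) (B : {set 'I_n}) :
  (forall u w, u \in B -> w \in B -> cell u = cell w -> w \in cl_nbhd G u) ->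
  exists2 X : {set 'I_n}, #|X| <= #|C| * 3 &
    forall u, u \in B -> u \in X \/ 3 <= #|cl_nbhd G u :&: X|.
Proof.
move=> cl; pose S c := [set u in B | cell u == c].
pose rk u := index u (enum (S (cell u))).
have inS u : u \in B -> u \in enum (S (cell u)) by rewrite mem_enum inE eqxx andbT.
exists [set u in B | rk u < 3].
  set X := [set _ in _ | _]; pose h u : C * 'I_3 := (cell u, inord (rk u)).
  have hinj : {in X &, injective h}.
    move=> u w; rewrite !inE => /andP[uB ru] /andP[wB rw] [cuw /(congr1 val)].
    rewrite /= !inordK // => ruw.
    by rewrite -(nth_index u (inS u uB)) -(nth_index u (inS w wB)) -/(rk w) -ruw /rk cuw.
  by rewrite -(card_in_imset hinj); apply: leq_trans (max_card _) _; rewrite card_prod card_ord.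
move=> u uB; have [ru|ru] := ltnP (rk u) 3; [by left; rewrite inE uB|right].
have sz : 3 < size (enum (S (cell u))).
  by apply: leq_ltn_trans ru _; rewrite index_mem inS.
apply/card_geqP; exists (take 3 (enum (S (cell u)))); split.
- by rewrite take_uniq // enum_uniq.
- by rewrite size_take sz.
move=> z zt; have zS := mem_take zt.
have : z \in S (cell u) by rewrite -mem_enum.
rewrite inE => /andP[zB /eqP cz]; rewrite in_setI cl //= inE zB /rk cz.
rewrite -(cat_take_drop 3 (enum _)) index_cat zt.
by move: zt; rewrite -index_mem size_take sz.
Qed.

(** If some endpoint involved has three elements of [X] in its closed neighbourhood, this alone
    meets both thresholds. Otherwise all endpoints lie in [X], and two distinct edges have at least
    three endpoints. All of them are within 4 of [u]. *)
Lemma sat_of_dense (B X : {set 'I_n}) u :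
  (forall w, dist_le 4 u w -> w \in B) ->
  (forall w, w \in B -> w \in X \/ 3 <= #|cl_nbhd G w :&: X|) -> sat X u.
Proof.
move=> nB dense w uw.
have memX s : (forall h, h \in s -> dist_le 4 u h) -> forall k, k <= 3 ->
    k <= #|[set h in s]| -> k <= #|hood s :&: X|.
  move=> sn k k3 ks.
  have [/existsP[h /andP[hs hX]]|/existsPn nh] :=
    boolP [exists h, (h \in s) && (3 <= #|cl_nbhd G h :&: X|)].
    apply: leq_trans k3 (leq_trans hX (subset_leq_card _)).
    apply/setSI/subsetP=> z zh; rewrite inE; apply/hasP; by exists h.
  apply: leq_trans ks (subset_leq_card _); apply/subsetP=> h.
  rewrite inE => hs; have /nB/dense[hX|] := sn _ hs; last by have := nh h; rewrite hs => /negP.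
  by rewrite !inE hX andbT; apply/hasP; exists h => //; rewrite in_cl_nbhd eqxx.
have uw4 : dist_le 4 u w by apply: dist_le_leq (dist_le_adj uw).
have nuw : u != w by apply: contraTneq uw => ->; rewrite adj_irr.
split=> [|x y xy ux ne].
  apply: memX => // [h|].
    by rewrite !inE => /orP[]/eqP-> //; apply: dist_le_refl.
  have -> : [set h in [:: u; w]] = [set u; w] by apply/setP=> z; rewrite !inE.
  by rewrite cards2 nuw.
apply: memX => // [h|].
  rewrite !inE => /or4P[]/eqP-> //; first exact: dist_le_refl.
    exact: dist_le_leq ux.
  exact: dist_le_trans ux (dist_le_adj xy).
have nxy : x != y by apply: contraTneq xy => ->; rewrite adj_irr.
(* Distinct edges share at most one endpoint: if [x] is on the first edge, then [y] is not. *)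
apply/card_geqP; exists (if (x == u) || (x == w) then [:: u; w; y] else [:: u; w; x]).
move: ne nuw nxy.
rewrite [x == u]eq_sym [x == w]eq_sym.
case: (u =P x) => [<-|/eqP ux'] /=.
  rewrite orbC => ne nuw nuy; split=> //=.
    rewrite !inE negb_or nuw nuy /= andbT.
    by apply: contra ne => /eqP->; rewrite eqxx orbT.
  by move=> z; rewrite !inE => /or3P[]->; rewrite ?orbT.
case: (w =P x) => [<-|/eqP wx] /=.
  move=> ne nuw nwy; split=> //=.
    rewrite !inE negb_or nuw nwy /= !andbT.
    by apply: contra ne => /eqP->; rewrite eqxx.
  by move=> z; rewrite !inE => /or3P[]->; rewrite ?orbT.
move=> ne nuw nxy; split=> //=.
  by rewrite !inE negb_or nuw ux' wx.
by move=> z; rewrite !inE => /or3P[]->; rewrite ?orbT.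
Qed.

End Neighbourhoods.

(** * The program *)

(** The trailing [tt_prog] leaves a truth value in register 0, as [runs] demands of every
    program. *)
Definition store_prog a := Seq (SetMem a (Cst 1)) tt_prog.

Fixpoint dist_prog r d i j :=
  if r is r'.+1 then
    ex_prog d (and_prog (test_prog (test_cl i d)) (dist_prog r' d.+1 d j))
  else test_prog (test_eq i j).

Definition at_least_prog k d hs xs :=
  exs_prog k d (test_prog (test_and (test_uniq (iota d k))
    (test_all [seq test_and (test_mem z xs) (test_any [seq test_cl h z | h <- hs])
              | z <- iota d k]))).

Definition sat_prog d i xs :=
  forall_prog d (imp_prog (test_prog (Adj (Reg i) (Reg d)))
    (and_prog (at_least_prog 2 d.+1 [:: i; d] xs)
      (forall_prog d.+1 (forall_prog d.+2
        (imp_prog (test_prog (Adj (Reg d.+1) (Reg d.+2)))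
        (imp_prog (dist_prog 3 d.+3 i d.+1)
        (imp_prog (test_prog (test_not
           (Add (test_and (test_eq i d.+1) (test_eq d d.+2))
                (test_and (test_eq i d.+2) (test_eq d d.+1)))))
          (at_least_prog 3 d.+3 [:: i; d; d.+1; d.+2] xs)))))))).

(** Marks for covered vertices sit in the cells [n, ..., 2n-1], clear of the output in the cells
    below [n]. *)
Definition covered_cell i := Add GraphOrder (Reg i).

Definition solves_prog r d v xs :=
  forall_prog d (imp_prog (dist_prog r d.+1 v d)
    (imp_prog (test_prog (test_not (Mem (covered_cell d)))) (sat_prog d.+1 d xs))).

(** The inner search serves as a loop over all vertices, since its body always answers false. The
    final [tt_prog] reports success, which stops all enclosing searches. *)
Definition commit_prog r d v xs :=
  foldr (fun x q => Seq (store_prog (Reg x)) q)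
    (Seq (ex_prog d (cond_prog (dist_prog r d.+1 v d)
            (Seq (store_prog (covered_cell d)) ff_prog) ff_prog)) tt_prog) xs.

Definition option_prog r r' k ks :=
  exs_prog k 2 (and_prog (solves_prog r' (2 + k) 1 (iota 2 k))
    (and_prog (all_prog [seq not_prog (exs_prog k' (2 + k)
                 (solves_prog r (2 + k + k') 1 (iota (2 + k) k'))) | k' <- ks])
      (commit_prog r' (2 + k) 1 (iota 2 k)))).

(* [below k' k] says that a solution of size k for the ball of radius 10(j+1)
   is too large if the ball of radius 10j has one of size k'. As [sat] looks at
   distance 5, the gap of 10 makes the sets charged in different rounds
   disjoint. *)
Definition search_prog J M (below : rel nat) :=
  any_prog [seq any_prog [seq option_prog (10 * j) (10 * j.+1) k
                                [seq k' <- iota 0 k | below k' k]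
                         | k <- iota 0 M.+1]
           | j <- iota 0 J].

(** Again a search that never succeeds, used as a loop over all possible centres in register 1. *)
Definition main_prog J M below :=
  ex_prog 1 (cond_prog (test_prog (Mem (covered_cell 1))) ff_prog
    (cond_prog (search_prog J M below) ff_prog ff_prog)).

(** * Correctness and running time of the program *)

Section Programs.
Variables (n : nat) (G : graph n).
Implicit Types (d i j : nat) (f m : nat -> nat) (s : state).

Lemma eval_not s a : (eval G s (test_not a) != 0) = ~~ (eval G s a != 0).
Proof. by rewrite /=; case: (eval G s a). Qed.

Lemma eval_add s a b :
  (eval G s (Add a b) != 0) = (eval G s a != 0) || (eval G s b != 0).
Proof. by rewrite /= addn_eq0 negb_and. Qed.

Lemma eval_and s a b :
  (eval G s (test_and a b) != 0) = (eval G s a != 0) && (eval G s b != 0).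
Proof. by rewrite eval_not eval_add !eval_not negb_or !negbK. Qed.

Lemma eval_eq s i j : (eval G s (test_eq i j) != 0) = (regs s i == regs s j).
Proof. by rewrite -/(test_not _) eval_not /= negbK; lia. Qed.

Lemma eval_any s es :
  (eval G s (test_any es) != 0) = has (fun e => eval G s e != 0) es.
Proof. by elim: es => //= e es <-; rewrite addn_eq0 negb_and. Qed.

Lemma eval_all s es :
  (eval G s (test_all es) != 0) = all (fun e => eval G s e != 0) es.
Proof. by elim: es => // e es IH; rewrite [test_all _]/= eval_and IH. Qed.

Lemma eval_mem s i js :
  (eval G s (test_mem i js) != 0) = (regs s i \in [seq regs s j | j <- js]).
Proof.
rewrite eval_any has_map; elim: js => //= j js IH.
by rewrite inE -eval_eq IH.
Qed.

Lemma eval_uniq s js :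
  (eval G s (test_uniq js) != 0) = uniq [seq regs s j | j <- js].
Proof.
by elim: js => // i js IH; rewrite [test_uniq _]/= eval_and eval_not eval_mem IH.
Qed.

Lemma eval_adj s i j (u v : 'I_n) : regs s i = u -> regs s j = v ->
  (eval G s (Adj (Reg i) (Reg j)) != 0) = G u v.
Proof.
by move=> ui vj; rewrite [eval _ _ _]/= ui vj /adj_query !valK; case: (G u v).
Qed.

Lemma eval_cl s i j (u v : 'I_n) : regs s i = u -> regs s j = v ->
  (eval G s (test_cl i j) != 0) = (v \in cl_nbhd G u).
Proof.
move=> ui vj; rewrite eval_add eval_eq (eval_adj ui vj) ui vj in_cl_nbhd.
by rewrite (inj_eq val_inj).
Qed.

Lemma eval_hood s hs us j z :
  [seq regs s h | h <- hs] = [seq val u | u <- us] -> regs s j = val z ->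
  (eval G s (test_any [seq test_cl h j | h <- hs]) != 0) = (z \in hood G us).
Proof.
move=> hu jz; rewrite eval_any in_hood has_map.
elim: hs us hu => [|h hs IH] [|u us] //= [hu /IH<-].
by congr (_ || _); apply: eval_cl.
Qed.

Lemma upd_eq f d x : upd f d x d = x.
Proof. by rewrite /upd eqxx. Qed.

Lemma upd_lt f d x i : i < d -> upd f d x i = f i.
Proof. by rewrite /upd; case: eqVneq => // ->; rewrite ltnn. Qed.

Definition valued d f i (u : 'I_n) := 0 < i < d /\ f i = u.

Lemma valued_upd d f i u x : valued d f i u -> valued d.+1 (upd f d x) i u.
Proof.
rewrite /valued => -[/andP[i0 id] <-]; split; last by rewrite upd_lt.
by rewrite i0 ltnS ltnW.
Qed.

Lemma valued_new d f (x : 'I_n) : 0 < d -> valued d.+1 (upd f d x) d x.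
Proof. by move=> d0; split; rewrite ?upd_eq // d0 ltnSn. Qed.

Lemma decides_dist r d f m i j u v : valued d f i u -> valued d f j v ->
  decides G d f m (dist_prog r d i j) (r * 8 + 16) (dist_le G r u v).
Proof.
elim: r d f i u => [|r IH] d f i u ui vj.
  apply: decides_weaken (@decides_test _ _ d f m (test_eq i j) (u == v) _) => // s sf _.
  by rewrite eval_eq !sf ?(proj2 ui) ?(proj2 vj) ?(inj_eq val_inj) //; [case: vj|case: ui].
have d0 : 0 < d by case/andP: (proj1 vj) => _; apply: leq_ltn_trans.
have step (x : 'I_n) : decides G d.+1 (upd f d x) m
    (and_prog (test_prog (test_cl i d)) (dist_prog r d.+1 d j)) (r * 8 + 18)
    (x \in cl_nbhd G u /\ dist_le G r x v).
  have H := IH d.+1 (upd f d x) d x (valued_new f x d0) (valued_upd x vj).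
  apply: decides_weaken (decides_and (@decides_test _ G d.+1 (upd f d x) m
    (test_cl i d) (x \in cl_nbhd G u) _) (fun=> H)) => [/=||s sf _]; [lia|by []|].
  have [id ui'] := valued_upd x ui; have [dd xd] := valued_new f x d0.
  by apply: eval_cl; rewrite sf.
apply: decides_weaken (decides_ex d0 step); first lia.
by split=> [[x [H1 H2]]|/existsP[x /andP[H1 H2]]]; [apply/existsP; exists x; apply/andP|exists x].
Qed.

Definition valueds d f js (us : seq 'I_n) :=
  all (fun i => 0 < i < d) js /\ [seq f i | i <- js] = [seq val u | u <- us].

Lemma regs_valueds d f js us s : valueds d f js us ->
  (forall i, 0 < i < d -> regs s i = f i) ->
  [seq regs s i | i <- js] = [seq val u | u <- us].
Proof.
by case=> /allP jd <- sf; apply/eq_in_map=> i /jd; apply: sf.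
Qed.

Lemma valueds_ext d d' f g js us : d <= d' ->
  (forall i, 0 < i < d -> g i = f i) -> valueds d f js us -> valueds d' g js us.
Proof.
rewrite /valueds => dd gf [/allP jd <-]; split; last by apply/eq_in_map=> i /jd/gf.
by apply/allP=> i /jd/andP[-> id]; apply: leq_trans dd.
Qed.

Lemma valueds_upd d f js us x : valueds d f js us -> valueds d.+1 (upd f d x) js us.
Proof. by apply: valueds_ext => // i /andP[_ id]; rewrite upd_lt. Qed.

Lemma valued_ext d d' f g i u : d <= d' ->
  (forall i, 0 < i < d -> g i = f i) -> valued d f i u -> valued d' g i u.
Proof.
rewrite /valued => dd gf [id <-]; split; last exact: gf.
by move: id => /andP[-> id]; apply: leq_trans dd.
Qed.

Lemma valueds_iota d k g zs : 0 < d ->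
  [seq g i | i <- iota d k] = [seq val z | z <- zs] -> valueds (d + k) g (iota d k) zs.
Proof.
move=> d0 E; split=> //; apply/allP=> i; rewrite mem_iota => /andP[di ->].
by rewrite (leq_trans d0 di).
Qed.

Lemma cost_mem z xs : cost (test_mem z xs) = size xs * 10 + 1.
Proof.
elim: xs => [//|x xs IH]; rewrite -[test_mem _ _]/(Add (test_eq z x) (test_mem z xs)).
by rewrite -[cost _]/((cost (test_eq z x) + cost (test_mem z xs)).+1) IH /=; lia.
Qed.

Lemma cost_uniq js : cost (test_uniq js) <= size js * (size js * 10 + 10) + 1.
Proof.
elim: js => //= j js IH; rewrite cost_mem; move: (cost _) (size _) IH => x y; nia.
Qed.

Lemma cost_any I (e : I -> expr) zs c : (forall z, cost (e z) = c) ->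
  cost (test_any [seq e z | z <- zs]) = size zs * c.+1 + 1.
Proof. by move=> ec; elim: zs => //= z zs ->; rewrite ec; lia. Qed.

Lemma cost_all I (e : I -> expr) zs c : (forall z, cost (e z) = c) ->
  cost (test_all [seq e z | z <- zs]) = size zs * (c + 7) + 1.
Proof. by move=> ec; elim: zs => //= z zs ->; rewrite ec; lia. Qed.

(** A set has at least [k] elements when it contains a duplicate-free list of length [k], which the
    machine guesses. The test is unrolled over the registers in [xs] and [hs], so its cost is
    independent of [n]. *)
Lemma decides_at_least k d f m hs us xs X : 0 < d ->
  valueds d f hs us -> valueds d f xs X ->
  decides G d f m (at_least_prog k d hs xs)
    (k * (k * 10 + size xs * 10 + size hs * 14 + 32) + 12)
    (k <= #|hood G us :&: [set x in X]|).
Proof.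
move=> d0 ush Xx; set e := test_and (test_uniq (iota d k)) (test_all
  [seq test_and (test_mem z xs) (test_any [seq test_cl h z | h <- hs]) | z <- iota d k]).
pose B zs := uniq zs && all (mem (hood G us :&: [set x in X])) zs.
have ce : cost e <= k * (k * 10 + size xs * 10 + size hs * 14 + 26) + 9.
  have cz z : cost (test_and (test_mem z xs) (test_any [seq test_cl h z | h <- hs])) =
      size xs * 10 + size hs * 14 + 9.
    by rewrite /= cost_mem (@cost_any _ (fun h => test_cl h z) hs 13) //; lia.
  have := cost_uniq (iota d k); rewrite /= (cost_all _ cz) size_iota.
  by move: (cost _) => x; lia.
apply: decides_weaken (@decides_exs _ G k d f m (test_prog e) (cost e + 3)
  (fun zs => B zs) d0 _) => [||zs g sz gf gz].
- by lia.
- split=> [[zs sz /andP[uz /allP az]]|/card_geqP[zs [uz sz az]]].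
    by apply/card_geqP; exists zs.
  by exists zs; rewrite /B ?uz //; apply/allP.
apply: decides_test => s sg _.
have rz := regs_valueds (valueds_iota d0 gz) sg.
have dk : d <= d + k by apply: leq_addr.
have rx := regs_valueds (valueds_ext dk gf Xx) sg.
have ru := regs_valueds (valueds_ext dk gf ush) sg.
rewrite eval_and eval_uniq rz (map_inj_uniq val_inj); congr (_ && _).
rewrite eval_all all_map.
elim: (iota d k) zs rz {gz sz} => [|j js IH] [|z zs] //= [jz /IH->].
congr (_ && _); rewrite eval_and eval_mem rx jz (mem_map val_inj) in_setI andbC inE.
by rewrite (eval_hood ru jz).
Qed.

Lemma valueds_nil d f : valueds d f [::] [::].
Proof. by []. Qed.

Lemma valueds_cons d f i u js us :
  valued d f i u -> valueds d f js us -> valueds d f (i :: js) (u :: us).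
Proof. by move=> [id fi] [jd fjs]; split; rewrite /= ?id ?fi ?fjs. Qed.

Lemma decides_adj d f m i j u v : valued d f i u -> valued d f j v ->
  decides G d f m (test_prog (Adj (Reg i) (Reg j))) 6 (G u v).
Proof.
move=> [id iu] [jd jv]; apply: decides_test => s sf _.
by apply: eval_adj; rewrite sf.
Qed.

Lemma decides_sat d f m i u xs X : 0 < d ->
  valued d f i u -> valueds d f xs X ->
  decides G d f m (sat_prog d i xs) (500 + size xs * 50) (sat G [set x in X] u).
Proof.
move=> d0 iu xX.
have H (w x y : 'I_n) (f3 := upd (upd (upd f d w) d.+1 x) d.+2 y) :
  decides G d.+3 f3 m (imp_prog (test_prog (Adj (Reg d.+1) (Reg d.+2)))
        (imp_prog (dist_prog 3 d.+3 i d.+1)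
        (imp_prog (test_prog (test_not
           (Add (test_and (test_eq i d.+1) (test_eq d d.+2))
                (test_and (test_eq i d.+2) (test_eq d d.+1)))))
          (at_least_prog 3 d.+3 [:: i; d; d.+1; d.+2] xs)))) (400 + size xs * 30)
    (G x y -> dist_le G 3 u x ->
      ~~ ((u == x) && (w == y) || (u == y) && (w == x)) ->
      3 <= #|hood G [:: u; w; x; y] :&: [set x in X]|).
  have vi : valued d.+3 f3 i u by do 3 apply: valued_upd.
  have vw : valued d.+3 f3 d w by do 2 apply: valued_upd; apply: valued_new.
  have vx : valued d.+3 f3 d.+1 x by apply: valued_upd; apply: valued_new.
  have vy : valued d.+3 f3 d.+2 y by apply: valued_new.
  have vX : valueds d.+3 f3 xs X by do 3 apply: valueds_upd.
  have Hal := @decides_at_least 3 d.+3 f3 m _ _ xs X isT (valueds_cons vi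
    (valueds_cons vw (valueds_cons vx (valueds_cons vy (valueds_nil _ _))))) vX.
  have Ht : decides G d.+3 f3 m (test_prog (test_not
      (Add (test_and (test_eq i d.+1) (test_eq d d.+2))
           (test_and (test_eq i d.+2) (test_eq d d.+1))))) 60
      (~~ ((u == x) && (w == y) || (u == y) && (w == x))).
    apply: decides_weaken (@decides_test n G d.+3 f3 m _
      (~~ ((u == x) && (w == y) || (u == y) && (w == x))) _) => // s sf _.
    rewrite eval_not eval_add !eval_and !eval_eq.
    by rewrite !sf ?(proj2 vi) ?(proj2 vw) ?(proj2 vx) ?(proj2 vy) ?(inj_eq val_inj) //;
      case: vi vw vx vy => ? _ [? _] [? _] [? _].
  apply: decides_weaken (decides_imp (decides_adj vx vy) (fun=>
    decides_imp (decides_dist 3 vi vx) (fun=> decides_imp Ht (fun=> Hal)))) => //.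
  by rewrite /=; lia.
have H1 w := decides_forall (isT : 0 < d.+1) (fun x =>
  decides_forall (isT : 0 < d.+2) (fun y => H w x y)).
have Hal (w : 'I_n) := @decides_at_least 2 d.+1 (upd f d w) m _ _ xs X isT
  (valueds_cons (valued_upd w iu) (valueds_cons (valued_new f w d0) (valueds_nil _ _)))
  (valueds_upd w xX).
have H2 (w : 'I_n) := decides_imp (decides_adj (m := m) (valued_upd w iu) (valued_new f w d0))
  (fun=> decides_and (Hal w) (fun=> H1 w)).
by apply: decides_weaken (decides_forall d0 H2); first by rewrite /=; lia.
Qed.

Definition chosen m : {set 'I_n} := [set i : 'I_n | m i != 0].
Definition covered m : {set 'I_n} := [set u : 'I_n | m (n + u) != 0].

Definition solves (C : {set 'I_n}) r v (X : seq 'I_n) :=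
  forall u, dist_le G r v u -> u \notin C -> sat G [set x in X] u.

Lemma decides_solves r d f m i v xs X : valued d f i v -> valueds d f xs X ->
  decides G d f m (solves_prog r d i xs) (600 + r * 8 + size xs * 50)
    (solves (covered m) r v X).
Proof.
move=> iv xX; have d0 : 0 < d by case/andP: (proj1 iv) => _; apply: leq_ltn_trans.
have H (u : 'I_n) := @decides_sat d.+1 (upd f d u) m d u xs X isT
  (valued_new f u d0) (valueds_upd u xX).
have Ht (u : 'I_n) : decides G d.+1 (upd f d u) m
    (test_prog (test_not (Mem (covered_cell d)))) 9 (u \notin covered m).
  apply: decides_test => s sf sm; rewrite eval_not /= sm sf ?upd_eq ?inE //.
  by rewrite d0 ltnSn.
have Hd (u : 'I_n) := decides_dist r (m := m) (valued_upd u iv) (valued_new f u d0).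
have H2 (u : 'I_n) := decides_imp (Hd u) (fun=> decides_imp (Ht u) (fun=> H u)).
by apply: decides_weaken (decides_forall d0 H2); first lia.
Qed.

Lemma chosen_upd m (x : 'I_n) : chosen (upd m x 1) = x |: chosen m.
Proof.
by apply/setP=> y; rewrite !inE /upd (inj_eq val_inj); case: (y == x).
Qed.

Lemma covered_upd_chosen m (x : 'I_n) : covered (upd m x 1) = covered m.
Proof.
apply/setP=> y; rewrite !inE /upd; case: (n + y =P x) => // yx.
by have := ltn_ord x; lia.
Qed.

Lemma covered_upd m (x : 'I_n) : covered (upd m (n + x) 1) = x |: covered m.
Proof.
by apply/setP=> y; rewrite !inE /upd eqn_add2l (inj_eq val_inj); case: (y == x).
Qed.

Lemma chosen_upd_covered m (x : 'I_n) : chosen (upd m (n + x) 1) = chosen m.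
Proof.
apply/setP=> y; rewrite !inE /upd; case: (nat_of_ord y =P n + x) => // yx.
by have := ltn_ord y; lia.
Qed.

Lemma runs_cover r d f m i v : valued d f i v ->
  runs G d f m (Seq (ex_prog d (cond_prog (dist_prog r d.+1 i d)
            (Seq (store_prog (covered_cell d)) ff_prog) ff_prog)) tt_prog)
    (r * 8 + 30)
    (fun b m' => [/\ b, chosen m' = chosen m
      & covered m' = covered m :|: [set u | dist_le G r v u]]).
Proof.
move=> iv; have d0 : 0 < d by case/andP: (proj1 iv) => _; apply: leq_ltn_trans.
pose I k m' := chosen m' = chosen m /\
  covered m' = covered m :|: [set u : 'I_n | dist_le G r v u & k <= u].
have I0 : I n m.
  split=> //; apply/setP=> u; rewrite !inE; case: (m _ != 0) => //=.
  by rewrite leqNgt ltn_ord andbF.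
(* [False] in the success case records that the body never answers true, so the loop reaches every
   vertex. *)
have step (u : 'I_n) m' : I u.+1 m' -> runs G d.+1 (upd f d u) m'
    (cond_prog (dist_prog r d.+1 i d)
       (Seq (store_prog (covered_cell d)) ff_prog) ff_prog) (r * 8 + 20)
    (fun b m'' => if b then False else I u m'').
  move=> [chI coI].
  have Hd := decides_dist r (m := m') (valued_upd u iv) (valued_new f u d0).
  apply: runs_weaken (runs_cond Hd (w' := 10) (Q' := fun b m'' => ~~ b /\ I u m'') _ _).
  - lia.
  - by move=> [] m'' [].
  - move=> _ [du ->]; have {}du := proj1 du erefl.
    have E s : (forall i, 0 < i < d.+1 -> regs s i = upd f d u i) -> memory s = m' ->
        eval G s (covered_cell d) = n + val u.
      by move=> sf _; rewrite /= sf ?upd_eq // d0 ltnSn.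
    apply: runs_weaken (runs_seq (w' := 2)
      (Q' := fun b m1 => ~~ b /\ m1 = upd m' (n + u) 1) (runs_store E) _) => //.
      move=> b m1 [nb ->]; split=> //; split; first by rewrite chosen_upd_covered.
      rewrite covered_upd coI; apply/setP=> z; rewrite !inE.
      rewrite [in RHS]leq_eqVlt eq_sym -(inj_eq val_inj) /=; case: eqVneq => [/val_inj <-|_] //=.
      by rewrite du orbT.
    by move=> b _ ->; apply: runs_ff.
  move=> _ [du ->]; apply: runs_weaken (@runs_ff _ G _ _ m') => // b m1 [nb ->]; split=> //.
  split=> //; rewrite coI; apply/setP=> z; rewrite !inE; congr (_ || _).
  rewrite [in RHS]leq_eqVlt; case: eqVneq => //= /val_inj <-.
  rewrite ltnn andbF andbT; apply/esym/negbTE/negP => vu; by have := proj2 du vu.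
have He := runs_ex d0 I0 step.
apply: runs_weaken (runs_seq (w' := 2) He (Q' := fun b m' => [/\ b, chosen m' = chosen m
      & covered m' = covered m :|: [set u | dist_le G r v u]]) _) => // [|[] // m' [cI coI]].
  lia.
apply: runs_weaken (@runs_tt _ G _ _ m') => // b m1 [-> ->]; split=> //.
by rewrite coI; apply/setP=> z; rewrite !inE andbT.
Qed.

Lemma runs_commit r d f m i v xs X : valued d f i v -> valueds d f xs X ->
  runs G d f m (commit_prog r d i xs) (30 + r * 8 + size xs)
    (fun b m' => [/\ b, chosen m' = [set x in X] :|: chosen m
      & covered m' = covered m :|: [set u | dist_le G r v u]]).
Proof.
move=> iv; elim: xs X m => [|x xs IH] [|y X] m [] //= jd.
  move=> _; apply: runs_weaken (runs_cover r (m := m) iv) => [|b m' [-> -> ->]]; first lia.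
  by split=> //; apply/setP=> z; rewrite !inE.
case/andP: jd => xd jd [xy xX].
have E s : (forall i, 0 < i < d -> regs s i = f i) -> memory s = m ->
    eval G s (Reg x) = y by move=> sf _ /=; rewrite sf.
apply: runs_weaken (runs_seq (w' := 30 + r * 8 + size xs) (runs_store E)
  (Q' := fun b m' => [/\ b, chosen m' = [set x in y :: X] :|: chosen m
      & covered m' = covered m :|: [set u | dist_le G r v u]]) _) => // [|b _ ->].
  by rewrite /=; lia.
apply: runs_weaken (IH X _ _) => // b' m' [-> -> ->].
rewrite chosen_upd covered_upd_chosen; split=> //.
by apply/setP=> z; rewrite !inE -!orbA; case: (z == y); rewrite ?orbT.
Qed.

Definition option_spec m r r' v k (ks : seq nat) (X : seq 'I_n) :=
  [/\ size X = k, solves (covered m) r' v X &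
    forall k' Y, k' \in ks -> size Y = k' -> ~ solves (covered m) r v Y].

Definition committed m m' r v (X : seq 'I_n) :=
  chosen m' = [set x in X] :|: chosen m /\
  covered m' = covered m :|: [set u | dist_le G r v u].

(** Each guessed vertex adds 6 to the exponent and the tests add an amount linear in the number of
    guessed vertices. As all sizes are at most [M], the exponent is linear in [r'] and [M]. *)
Lemma runs_option r r' k ks f m M v : valued 2 f 1 v -> k <= M -> r <= r' ->
  size ks <= M -> {in ks, forall k', k' <= M} ->
  runs G 2 f m (option_prog r r' k ks) (700 + r' * 8 + M * 70)
    (fun b m' => if b then exists2 X, option_spec m r r' v k ks X & committed m m' r' v X
      else m' = m /\ forall X, ~ option_spec m r r' v k ks X).
Proof.
move=> fv kM rr ksM ksM'.
pose T m' := exists2 X, option_spec m r r' v k ks X & committed m m' r' v X.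
pose F X := ~ (solves (covered m) r' v X /\
  forall k', k' \in ks -> ~ exists2 Y, size Y = k' & solves (covered m) r v Y).
apply: runs_weaken (runs_exs (w := 700 + r' * 8 + M * 60) (F := F) (T := T) (isT : 0 < 2) _) => //.
- lia.
- move=> [] // m' [-> HF]; split=> // X [sX sol nsol].
  by apply: (HF X sX); split=> // k' k'ks [Y sY]; apply: nsol sY.
move=> X g sX gf gX; have fv' : valued (2 + k) g 1 v by apply: valued_ext gf fv; apply: leq_addr.
have vX := valueds_iota (isT : 0 < 2) gX.
have H1 := decides_solves r' (m := m) fv' vX.
have H2 : decides G (2 + k) g m (all_prog [seq not_prog (exs_prog k' (2 + k)
    (solves_prog r (2 + k + k') 1 (iota (2 + k) k'))) | k' <- ks])
    (maxn (602 + r * 8 + M * 56) 2 + size ks * 2)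
    (forall k', k' \in ks -> ~ exists2 Y, size Y = k' & solves (covered m) r v Y).
  apply: decides_all => k' k'ks.
  have H : decides G (2 + k) g m (exs_prog k' (2 + k)
      (solves_prog r (2 + k + k') 1 (iota (2 + k) k'))) (600 + r * 8 + k' * 50 + k' * 6)
      (exists2 Y, size Y = k' & solves (covered m) r v Y).
    apply: decides_exs => // Y h sY hg hY.
    have hv : valued (2 + k + k') h 1 v by apply: valued_ext hg fv'; apply: leq_addr.
    have := decides_solves r (m := m) hv (valueds_iota (isT : 0 < 2 + k) hY).
    by rewrite size_iota.
  apply: decides_weaken (decides_not H) => //; have := ksM' _ k'ks; lia.
have H3 := runs_commit r' (m := m) fv' vX.
rewrite size_iota in H1 H3.
have H23 := runs_cond H2 (w' := 30 + r' * 8 + k)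
  (q := commit_prog r' (2 + k) 1 (iota 2 k)) (r := ff_prog)
  (Q' := fun b m' => if b then (forall k', k' \in ks ->
       ~ exists2 Y, size Y = k' & solves (covered m) r v Y) /\ committed m m' r' v X
     else m' = m /\ ~ forall k', k' \in ks ->
       ~ exists2 Y, size Y = k' & solves (covered m) r v Y).
apply: runs_weaken (runs_cond H1 (w' := 690 + r' * 8 + M * 58) (q := and_prog _ _) (r := ff_prog)
   (Q' := fun b m' => if b then T m' else m' = m /\ F X) _ _) => //.
- lia.
- move=> _ [sol ->]; have {}sol := proj1 sol erefl.
  apply: runs_weaken (H23 _ _) => [|[] m'|_ [ok ->]|_ [nok ->]].
  + lia.
  + move=> [nsol com]; exists X => //; split=> // k' Y k'ks sY sol'.
    by apply: (nsol k') => //; exists Y.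
  + by move=> [-> nsol]; split=> // -[].
  + have {}ok := proj1 ok erefl.
    by apply: runs_weaken H3 => // b m' [-> ? ?].
  + apply: runs_weaken (@runs_ff _ G _ _ m) => [|b _ [/negbTE-> ->]]; first lia.
    by split=> // /(proj2 nok).
move=> _ [nsol ->]; apply: runs_weaken (@runs_ff _ G _ _ m) => [|b _ [/negbTE-> ->]]; first lia.
by split=> // -[/(proj2 nsol)].
Qed.

Definition accepted below m v j k X :=
  option_spec m (10 * j) (10 * j.+1) v k [seq k' <- iota 0 k | below k' k] X.

Lemma runs_search J M below f m v : valued 2 f 1 v ->
  runs G 2 f m (search_prog J M below) (704 + J * 82 + M * 72)
    (fun b m' =>
      if b then exists j k X, [/\ j < J, k <= M, accepted below m v j k X
        & committed m m' (10 * j.+1) v X]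
      else m' = m /\ forall j k X, j < J -> k <= M -> ~ accepted below m v j k X).
Proof.
move=> fv; pose T m' := exists j k X, [/\ j < J, k <= M, accepted below m v j k X
  & committed m m' (10 * j.+1) v X].
have H j k : j < J -> k <= M -> runs G 2 f m (option_prog (10 * j) (10 * j.+1) k
    [seq k' <- iota 0 k | below k' k]) (700 + J * 80 + M * 70)
    (fun b m' => if b then T m' else m' = m /\ forall X, ~ accepted below m v j k X).
  move=> jJ kM; have sub : size [seq k' <- iota 0 k | below k' k] <= M.
    by rewrite size_filter; apply: leq_trans (count_size _ _) _; rewrite size_iota.
  apply: runs_weaken (runs_option (m := m) fv kM _ sub _) => [|[] m'||k'].
  - lia.
  - by case=> X acc com; exists j, k, X.
  - exact.
  - lia.
  - by rewrite mem_filter mem_iota => /andP[_]; lia.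
have H1 j (jJ : j \in iota 0 J) := runs_any (l := iota 0 M.+1) (fun k kM =>
  H j k (etrans (esym (mem_iota 0 J j)) jJ) (etrans (esym (mem_iota 0 M.+1 k)) kM)).
apply: runs_weaken (runs_any (l := iota 0 J) H1) => [|[] // m' [-> HF]].
  by rewrite !size_iota; lia.
by split=> // j k X jJ kM; apply: (HF j _ k); rewrite mem_iota.
Qed.

(** This separates the machine from the combinatorics: [I v L C] is an invariant of the chosen set
    [L] and the covered set [C] once all centres of index at least [v] are done. The third
    hypothesis guarantees that the search from an uncovered centre succeeds. *)
Lemma runs_main J M below (I : nat -> {set 'I_n} -> {set 'I_n} -> Prop) :
  I n set0 set0 ->
  (forall (v : 'I_n) L C, I v.+1 L C -> v \in C -> I v L C) ->
  (forall (v : 'I_n) m, v \notin covered m -> exists j k X,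
    [/\ j < J, k <= M & accepted below m v j k X]) ->
  (forall (v : 'I_n) m j k X, I v.+1 (chosen m) (covered m) ->
    v \notin covered m -> accepted below m v j k X ->
    I v ([set x in X] :|: chosen m)
      (covered m :|: [set u | dist_le G (10 * j.+1) v u])) ->
  exists t L, [/\ runs_to G (main_prog J M below) t L,
    t <= maxn n 2 ^ (720 + J * 82 + M * 72) & exists C, I 0 L C].
Proof.
move=> I0 skip found step.
pose Im k m := I k (chosen m) (covered m).
pose m0 : nat -> nat := fun=> 0.
have Im0 : Im n m0.
  rewrite /Im; have -> : chosen m0 = set0 by apply/setP=> x; rewrite !inE.
  by have -> : covered m0 = set0 by apply/setP=> x; rewrite !inE.
have body (v : 'I_n) m : Im v.+1 m ->
    runs G 2 (upd (fun=> 0) 1 v) m (cond_prog (test_prog (Mem (covered_cell 1))) ff_prog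
      (cond_prog (search_prog J M below) ff_prog ff_prog)) (714 + J * 82 + M * 72)
      (fun b m' => if b then False else Im v m').
  move=> Iv; have Ht : decides G 2 (upd (fun=> 0) 1 v) m
      (test_prog (Mem (covered_cell 1))) 7 (v \in covered m).
    by apply: decides_test => s sf sm; rewrite /= sm sf //= inE /upd.
  have stop w m' : 2 <= w -> Im v m' -> runs G 2 (upd (fun=> 0) 1 v) m' ff_prog w
      (fun b m' => if b then False else Im v m').
    by move=> w2 Iv'; apply: runs_weaken (@runs_ff _ G _ _ m') => // b _ [/negbTE-> ->].
  pose Q' (b : bool) m' := if b then False else Im v m'.
  have vv : valued 2 (upd (fun=> 0) 1 v) 1 v by apply: (@valued_new 1).
  apply: runs_weaken (runs_cond Ht (w' := 710 + J * 82 + M * 72) (Q' := Q') _ _) => [|b m' //||].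
  - lia.
  - move=> _ [vC ->]; apply: stop => //; apply: skip Iv _; exact: (proj1 vC).
  move=> _ [nvC ->]; have vC : v \notin covered m by apply/negP => /(proj2 nvC).
  apply: runs_weaken (runs_cond (runs_search J M below (m := m) vv)
    (w' := 2) (Q' := Q') _ _) => [|b m' //||].
  - lia.
  - move=> m' [j [k [X [_ _ acc [cI coI]]]]]; apply: stop => //.
    by rewrite /Im cI coI; apply: step acc.
  - move=> m' [_ none]; have [j [k [X [jJ kM acc]]]] := found v m vC.
    by case: (none j k X).
have [|t [s [E tw _ [b b0 Qb]]]] := runs_ex (isT : 0 < 1) Im0 body (s := init_state) _ erefl.
  by case.
exists t, (output n s); split; first by exists s.
  by apply: leq_trans tw _; apply: leq_pexp2l; lia.
by exists (covered (memory s)); case: b Qb b0.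
Qed.

End Programs.

(** * Approximation ratio *)

Section Approximation.
Variables (R : realFieldType) (eps : R) (n : nat) (G : graph n).
Hypothesis eps_gt0 : (0 < eps)%R.

Definition too_small k' k := ((1 + eps) * k'%:R < k%:R)%R.

Lemma too_small_lt k' k : too_small k' k -> k' < k.
Proof.
rewrite /too_small -(ltr_nat R); apply: le_lt_trans.
by rewrite mulrDl mul1r lerDl mulr_ge0 ?ler0n // ltW.
Qed.

(** The first step only gives [m 1 >= 1], since [m 0] may vanish; each of the [J] further steps
    gains a factor [1 + eps]. *)
Lemma too_small_growth (m : nat -> nat) J :
  (forall j, j <= J -> too_small (m j) (m j.+1)) ->
  ((1 + eps) ^+ J <= (m J.+1)%:R)%R.
Proof.
elim: J => [|J IH] H.
  by rewrite expr0 (ler_nat R 1); apply: leq_ltn_trans (too_small_lt (H 0 isT)).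
rewrite exprS; apply: le_trans (ltW (H J.+1 (leqnn _))).
by rewrite ler_pM2l ?ltr_pwDl // ?ltr01 ?(ltW eps_gt0) //; apply: IH => j jJ; apply/H/leqW.
Qed.

(** Let [mn j] be the optimal size for radius [10 * j]. If an optimal solution for radius
    [10 * j.+1] is rejected, some solution for radius [10 * j] is too small, and so is [mn j].
    Rejection for all [j <= J] would make [mn] outgrow [M]. *)
Lemma accepted_exists J M (B : nat -> nat) :
  (forall r v, exists2 X : {set 'I_n}, #|X| <= B r &
    forall u, dist_le G r v u -> sat G X u) ->
  (forall j, j <= J.+1 -> B (10 * j) <= M) -> (M%:R < (1 + eps) ^+ J)%R ->
  forall (v : 'I_n) m, exists j k X,
    [/\ j < J.+1, k <= M & accepted G too_small m v j k X].
Proof.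
move=> HB BM growth v m.
pose sol j k := exists2 X, size X = k & solves G (covered n m) (10 * j) v X.
have ex_min j : exists k, [/\ k <= B (10 * j), sol j k & forall k', sol j k' -> k <= k'].
  have [X XB Xs] := HB (10 * j) v.
  have solX : sol j #|X|.
    exists (enum X); first by rewrite cardE.
    move=> u vu _; have -> : [set x in enum X] = X by apply/setP=> x; rewrite inE mem_enum.
    exact: Xs.
  have ex : exists k, boolp.asbool (sol j k) by exists #|X|; apply/boolp.asboolP.
  exists (ex_minn ex); case: ex_minnP => k /boolp.asboolP sk mk; split=> //.
    by apply: leq_trans XB; apply: mk; apply/boolp.asboolP.
  by move=> k' sk'; apply: mk; apply/boolp.asboolP.
have [mn mnP] := boolp.choice ex_min.
have mnM j : j <= J.+1 -> mn j <= M.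
  by move=> jJ; have [H _ _] := mnP j; apply: leq_trans H (BM _ jJ).
apply: boolp.contrapT => none.
suff /too_small_growth : forall j, j <= J -> too_small (mn j) (mn j.+1).
  by rewrite leNgt (le_lt_trans _ growth) // ler_nat mnM.
move=> j jJ; have [_ [X sX solX] _] := mnP j.+1.
apply: boolp.contrapT => small; apply: none; exists j, (mn j.+1), X; split=> //.
  exact: mnM.
split=> // k' Y; rewrite mem_filter => /andP[bel _] sY solY; apply: small.
have [_ _ /(_ k')le] := mnP j.
apply: le_lt_trans bel; rewrite ler_pM2l ?ltr_pwDl ?ltr01 ?(ltW eps_gt0) //.
by rewrite ler_nat; apply: le; exists Y.
Qed.

Variable Lopt : {set 'I_n}.
Hypothesis Lopt_liar : liar_ve_dominating G Lopt.

(* P is the part of the optimum that the output L has been charged to. *)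
Definition charged k (L C : {set 'I_n}) := exists P : {set 'I_n},
  [/\ P \subset Lopt, (#|L|%:R <= (1 + eps) * #|P|%:R)%R,
    forall u, u \in C -> sat G L u,
    forall u z, u \notin C -> z \in P -> ~~ dist_le G 5 u z &
    forall v : 'I_n, k <= v -> v \in C].

Lemma charged_start : charged n set0 set0.
Proof.
exists set0; split=> [||u|u z _|v]; rewrite ?sub0set ?cards0 ?mulr0 ?inE //.
by rewrite leqNgt ltn_ord.
Qed.

Lemma charged_skip (v : 'I_n) L C : charged v.+1 L C -> v \in C -> charged v L C.
Proof.
case=> P [? ? ? ? cov] vC; exists P; split=> // u.
by rewrite leq_eqVlt => /orP[/eqP/val_inj<-|/cov].
Qed.

Lemma charged_step (v : 'I_n) m j k X :
  charged v.+1 (chosen n m) (covered n m) -> v \notin covered n m ->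
  accepted G too_small m v j k X ->
  charged v ([set x in X] :|: chosen n m)
    (covered n m :|: [set u | dist_le G (10 * j.+1) v u]).
Proof.
case=> P [PL LP satL far cov] vC [sX solX minX].
set C := covered n m in far cov vC solX minX *; set L := chosen n m in LP satL *.
(* [S] is the part of the optimum that pays for [X]. By locality it solves the smaller ball, so its
   size is not among those excluded when [X] was accepted. *)
pose S := [set z in Lopt | [exists u, [&& dist_le G (10 * j) v u, u \notin C & dist_le G 5 u z]]].
have solS : solves G C (10 * j) v (enum S).
  move=> u vu uC; apply: sat_local (proj1 (liar_sat G Lopt) Lopt_liar u) => z uz zL.
  by rewrite inE mem_enum inE zL; apply/existsP; exists u; rewrite vu uC.
have kS : (k%:R <= (1 + eps) * #|S|%:R)%R.
  rewrite leNgt; apply/negP => small.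
  apply: (minX #|S| (enum S)) solS; last by rewrite cardE.
  by rewrite mem_filter mem_iota /= (too_small_lt small) andbT.
(* Elements of [P] are more than 5 away from every uncovered vertex, elements of [S] within 5 of
   one. *)
have PS : [disjoint P & S].
  apply/pred0P=> z /=; apply/negbTE/negP => /andP[zP].
  rewrite inE => /andP[_ /existsP[u /and3P[_ uC uz]]].
  by rewrite (negbTE (far u z uC zP)) in uz.
exists (P :|: S); split.
- by rewrite subUset PL; apply/subsetP=> z; rewrite inE => /andP[].
- have cX : #|[set x in X]| <= k by rewrite -sX cardsE card_size.
  have cL : (#|[set x in X] :|: L|%:R <= k%:R + #|L|%:R :> R)%R.
    by rewrite -natrD ler_nat; apply: leq_trans (leq_card_setU _ _) _; rewrite leq_add2r.
  apply: le_trans cL _; have /eqP -> : #|P :|: S| == #|P| + #|S| by rewrite (leq_card_setU P S).2.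
  by rewrite natrD mulrDr addrC lerD.
- move=> u; rewrite in_setU => uC'.
  have [uC|uC] := boolP (u \in C).
    by apply: sat_local (satL u uC) => z _ zL; rewrite inE zL orbT.
  move: uC'; rewrite (negbTE uC) inE /= => vu.
  by apply: sat_local (solX u vu uC) => z _ zX; rewrite in_setU zX.
- move=> u z; rewrite !in_setU negb_or => /andP[uC]; rewrite in_set => nvu /orP[/(far u z uC)//|].
  rewrite inE => /andP[_ /existsP[w /and3P[vw _ wz]]].
  apply: contra nvu => uz.
  (* A vertex within 5 of [S] is within [10 * j + 5 + 5] of [v], so it lies in the larger ball,
     which is now covered. *)
  have := dist_le_trans (dist_le_trans vw wz) (dist_le_sym uz).
  by apply: dist_le_leq; lia.
- move=> u; rewrite leq_eqVlt => /orP[/eqP/val_inj<-|/cov uC].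
    by rewrite !inE dist_le_refl orbT.
  by rewrite in_setU uC.
Qed.

Lemma charged_end L C : charged 0 L C ->
  liar_ve_dominating G L /\ (#|L|%:R <= (1 + eps) * #|Lopt|%:R)%R.
Proof.
case=> P [PL LP satL _ cov]; split.
  by apply/liar_sat => u; apply/satL/cov.
apply: le_trans LP _; rewrite ler_pM2l ?ltr_pwDl ?ltr01 ?(ltW eps_gt0) //.
by rewrite ler_nat subset_leq_card.
Qed.

End Approximation.

(** With [x = l + 9], the base is at most [2 ^ 8 * 2 ^ l * x] and [x < 2 ^ x], so the square is at
    most [2 ^ (16 + 2 * l + 2 * x)]. The factor 3 is below [2 ^ 2], and the 9 is chosen so that
    [18 + 2 * l = 2 * x]. *)
Lemma ball_bound_lt_pow q l (J := q * (4 * (l + 9))) : 0 < q -> q < 2 ^ l ->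
  (4 * (10 * J.+1 + 4)).+1 ^ 2 * 3 < 2 ^ (4 * (l + 9)).
Proof.
rewrite /J => q0 ql; set x := l + 9.
have xx : x < 2 ^ x by apply: ltn_expl.
have a1 : (4 * (10 * (q * (4 * x)).+1 + 4)).+1 <= 2 ^ 8 * (2 ^ l * x).
  have : q * x <= 2 ^ l * x by rewrite leq_mul2r ltnW ?orbT.
  have : 1 * 9 <= 2 ^ l * x by apply: leq_mul; rewrite ?expn_gt0 // leq_addl.
  by move: (2 ^ l * x) => y; rewrite mulnCA; move: (q * x) => z; lia.
apply: leq_ltn_trans (_ : (2 ^ 8 * (2 ^ l * x)) ^ 2 * 3 < _).
  by rewrite leq_mul2r leq_exp2r // a1 orbT.
rewrite !expnMn -!expnM.
apply: leq_ltn_trans (_ : 2 ^ (8 * 2) * (2 ^ (l * 2) * 2 ^ (x * 2)) * 3 < _).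
  by rewrite leq_mul2r !leq_mul2l [2 ^ (x * 2)]expnM leq_exp2r // (ltnW xx) !orbT.
rewrite -!expnD; apply: leq_trans (_ : 2 ^ (8 * 2 + (l * 2 + x * 2)) * 2 ^ 2 <= _).
  by rewrite ltn_mul2l expn_gt0.
by rewrite -expnD leq_exp2l // /x; lia.
Qed.

From mathcomp Require Import all_classical all_reals all_analysis.
Import Order.TTheory GRing.Theory Num.Theory.
Import numFieldNormedType.Exports.
Local Open Scope classical_set_scope.
Local Open Scope ring_scope.

(** * Unit disk graphs *)

Section Disks.
Variables (R : realType) (n : nat) (G : graph n).

Lemma coord_dist_le (ctr : 'I_n -> R * R) (pr : R * R -> R) :
  (forall u w, G u w -> `|pr (ctr u) - pr (ctr w)| <= 1) ->
  forall r (u v : 'I_n), dist_le G r u v -> `|pr (ctr u) - pr (ctr v)| <= r%:R.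
Proof.
move=> H; elim=> [|r IH] u v /=; first by move/eqP->; rewrite subrr normr0.
case/existsP=> w /andP[]; rewrite in_cl_nbhd => uw /IH wv.
rewrite -(subrK (pr (ctr w)) (pr (ctr u))) -addrA -natr1 addrC.
apply: le_trans (ler_normD _ _) _; apply: lerD => //.
by case/orP: uw => [/eqP->|/H //]; rewrite subrr normr0.
Qed.

(** The centres of the ball of radius [r + 4] lie in a square of side [2 * (r + 4)], cut into cells
    of side 1/2. Two centres in one cell are at distance less than 1, so cells are cliques. The
    extra 4 is the margin needed by [sat_of_dense]. *)
Lemma ball_solution : unit_disk_graph R G -> forall r v,
  exists2 X : {set 'I_n}, (#|X| <= (4 * (r + 4)).+1 ^ 2 * 3)%N &
    forall u, dist_le G r v u -> sat G X u.
Proof.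
case=> ctr Hctr r v; set r' := (r + 4)%N.
have adjP i j : i != j -> G i j <->
    ((ctr i).1 - (ctr j).1) ^+ 2 + ((ctr i).2 - (ctr j).2) ^+ 2 <= 1.
  move=> ij; rewrite Hctr // unit_disk_meet edist_le ?expr1n //.
have abs1 i j : G i j -> `|(ctr i).1 - (ctr j).1| <= 1 /\ `|(ctr i).2 - (ctr j).2| <= 1.
  move=> Gij; have ij : i != j by apply: contraTneq Gij => ->; rewrite adj_irr.
  have := proj1 (adjP i j ij) Gij; set a := _ - _; set b := _ - _ => ab.
  have := sqr_ge0 a; have := sqr_ge0 b => ha hb.
  by rewrite !ler_norml; split; apply/andP; split; nra.
have coord1 := coord_dist_le (fun u w h => proj1 (abs1 u w h)).
have coord2 := coord_dist_le (fun u w h => proj2 (abs1 u w h)).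
(* Scaling by 2 gives mesh 1/2 and the shift makes the value nonnegative. It can equal [4 * r'] at
   the border, hence the successor in the type. *)
pose c (pr : R * R -> R) u : 'I_(4 * r').+1 :=
  inord (Num.truncn (2 * (pr (ctr u) - pr (ctr v)) + 2 * r'%:R)).
have same_cell (pr : R * R -> R) u w : c pr u = c pr w ->
    `|pr (ctr v) - pr (ctr u)| <= r'%:R -> `|pr (ctr v) - pr (ctr w)| <= r'%:R ->
    `|pr (ctr u) - pr (ctr w)| <= 2^-1.
  rewrite /c; set a := pr (ctr u); set b := pr (ctr w); set o := pr (ctr v).
  have bound (e : R) : `|o - e| <= r'%:R -> 0 <= 2 * (e - o) + 2 * r'%:R <= (4 * r')%:R.
    by rewrite natrM ler_norml => /andP[e1 e2]; apply/andP; split; lra.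
  move=> /(congr1 val) cab /bound/andP[a0 a4] /bound/andP[b0 b4].
  have ta := truncn_itv a0; have tb := truncn_itv b0.
  have lt (x : R) : 0 <= x -> x <= (4 * r')%:R -> (Num.truncn x < (4 * r').+1)%N.
    move=> x0 x4; rewrite ltnS -(ler_nat R); apply: le_trans x4.
    by case/andP: (truncn_itv x0).
  move: cab; rewrite /= !inordK ?lt // => cab; rewrite cab in ta.
  case/andP: ta tb => ta1 ta2 /andP[tb1 tb2]; rewrite -natr1 in ta2 tb2.
  by rewrite ler_norml; apply/andP; split; lra.
have [u w|X cX dense] := @class_representatives n G _
    (fun u => (c fst u, c snd u)) [set u | dist_le G r' v u].
  rewrite in_cl_nbhd !inE => vu vw [c1 c2].
  have [//|uw /=] := eqVneq u w; apply/(adjP _ _ uw).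
  have := same_cell _ _ _ c1 (coord1 _ _ _ vu) (coord1 _ _ _ vw).
  have := same_cell _ _ _ c2 (coord2 _ _ _ vu) (coord2 _ _ _ vw).
  by rewrite !ler_norml => /andP[? ?] /andP[? ?]; nra.
exists X; first by rewrite card_prod !card_ord -mulnn in cX *.
move=> u vu; apply: sat_of_dense dense => w uw; rewrite inE.
exact: dist_le_trans vu uw.
Qed.

End Disks.

(** * The number of radii as a function of epsilon *)

Definition inv_ceil (R : realType) (e : R) : nat := (Num.truncn e^-1).+1.

(* With q = inv_ceil e, (1+e)^q >= 2, so the factor gained in this many steps
   is 2^(4(log q + O(1))), which exceeds the quadratic bound on the size of
   solutions. *)
Definition radius_steps (R : realType) (e : R) : nat :=
  (inv_ceil e * (4 * ((trunc_log 2 (inv_ceil e)).+1 + 9)))%N.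

Lemma bernoulli_le (R : realFieldType) (e : R) q : 0 <= e -> 1 + e *+ q <= (1 + e) ^+ q.
Proof.
move=> e0; elim: q => [|q IH]; first by rewrite mulr0n addr0 expr0.
rewrite exprS; apply: le_trans (ler_wpM2l _ IH); last by rewrite addr_ge0.
have : 0 <= e * (e *+ q) by rewrite mulr_ge0 // mulrn_wge0.
by rewrite mulrS; set x := e *+ q; lra.
Qed.

Lemma ball_bound_lt_growth (R : realType) (e : R) (J := radius_steps e) : 0 < e ->
  ((4 * (10 * J.+1 + 4)).+1 ^ 2 * 3)%:R < (1 + e) ^+ J.
Proof.
move=> e0; set q := inv_ceil e.
have qe : 1 <= e *+ q.
  rewrite -mulr_natr mulrC -ler_pdivrMr // mul1r ltW //.
  exact: truncnS_gt.
have pow2 : 2 <= (1 + e) ^+ q :> R.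
  by apply: le_trans (bernoulli_le q (ltW e0)); lra.
have ql : (q < 2 ^ (trunc_log 2 q).+1)%N by apply: trunc_log_ltn.
have := ball_bound_lt_pow (q := q) isT ql; rewrite -(ltr_nat R) => /lt_le_trans; apply.
rewrite natrX /J /radius_steps [X in _ <= X]exprM lerXn2r // nnegrE ?exprn_ge0 //; lra.
Qed.

Lemma radius_steps_bigO (R : realType) :
  (fun e : R => (radius_steps e).+1%:R : R) =O_ (0^'+) (fun e : R => e^-1 * ln e^-1).
Proof.
have ln2 : 0 < ln 2 :> R by apply: ln_gt0; rewrite ltr1n.
(* With [a = e^-1] and [y = ln a]: [q <= 2 * a] and [(l + 10) * ln 2 <= 12 * y] bound the main term
   times [ln 2] by [96 * (a * y)]. The successor adds [ln 2 <= y <= a * y]. *)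
apply/eqO_exP; exists (97 / ln 2); first by rewrite divr_gt0.
near=> e; have e0 : 0 < e by near: e; apply: nbhs_right_gt.
have e2 : e < 2^-1 by near: e; apply: nbhs_right_lt; rewrite invr_gt0.
have a2 : 2 < e^-1 by rewrite -[2]invrK ltf_pV2 ?posrE ?invr_gt0.
rewrite /radius_steps; set q := inv_ceil e; set l := trunc_log 2 q.
set a := e^-1 in a2 *; set y := ln a.
have qa : q%:R <= 2 * a.
  have : (Num.truncn a)%:R <= a by rewrite truncn_le; lra.
  by rewrite /q /inv_ceil -natr1 -/a; lra.
have y2 : ln 2 <= y by rewrite ler_ln ?posrE; lra.
have ly : l%:R * ln 2 <= ln 2 + y.
  rewrite -lnM ?posrE; [|lra|lra].
  have a_gt0 : 0 < 2 * a by lra.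
  rewrite mulr_natl -lnXn // ler_ln ?posrE ?exprn_gt0 //.
  by apply: le_trans qa; rewrite -natrX ler_nat; apply: trunc_logP.
rewrite normr_nat ger0_norm; last by rewrite mulr_ge0; lra.
have -> : 97 / ln 2 * (a * y) = 97 * (a * y) / ln 2 by rewrite mulrAC.
have -> : (q * (4 * (l.+1 + 9))).+1%:R = q%:R * (4 * (l%:R + 10)) + 1 :> R.
  by rewrite -natr1 !natrM natrD -[l.+1%:R]natr1; ring.
rewrite ler_pdivlMr // mulrDl mul1r -mulrA -[4 * _ * _]mulrA mulrDl.
have h : q%:R * (4 * (l%:R * ln 2 + 10 * ln 2)) <= 2 * a * (4 * (12 * y)).
  by apply: ler_pM => //; rewrite ?mulr_ge0 ?addr_ge0 ?mulr_ge0 ?ler0n ?(ltW ln2) //; lra.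
have : y <= a * y by rewrite ler_peMl; lra.
by move: h; set b := a * y; rewrite (_ : 2 * a * _ = 96 * b) /b; [lra|ring].
Unshelve. all: by end_near.
Qed.

Theorem theorem18 (R : realType) :
  exists (c : R -> nat) (K : nat),
    (fun e : R => (c e)%:R : R) =O_ (0^'+) (fun e : R => e^-1 * ln e^-1) /\
    forall eps : R, 0 < eps ->
      exists p : prog, forall (n : nat) (G : graph n), unit_disk_graph R G ->
        exists (t : nat) (L : {set 'I_n}),
          [/\ runs_to G p t L,
              ((1 < n)%N -> (t <= n ^ (K * c eps ^ 2))%N),
              liar_ve_dominating G L &
              #|L|%:R <= (1 + eps) * (min_liar_size G)%:R].
Proof.
(* Below, [M <= 3 * 2 ^ 12 * J.+1 ^ 2], and 1024 is ample for [72 * 3] and the lower order terms of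
   the exponent. *)
exists (fun e => (radius_steps e).+1), (1024 * 2 ^ 12)%N; split; first exact: radius_steps_bigO.
move=> eps eps0; set J := radius_steps eps.
pose M := ((4 * (10 * J.+1 + 4)).+1 ^ 2 * 3)%N.
(* The real number [eps] enters the program only through [J], [M] and a finite table of comparisons
   of sizes up to [M], fixed before any graph is read. *)
exists (main_prog J.+1 M (too_small eps)) => n G udg.
have [[Lopt LoptP cLopt] _] := min_liar_sizeP G.
have [||||t [L [run tw [C end_]]]] := @runs_main n G J.+1 M (too_small eps) (charged eps G Lopt).
- exact: charged_start.
- exact: charged_skip.
- move=> v m _; apply: (@accepted_exists _ _ _ _ eps0 J M (fun r => (4 * (r + 4)).+1 ^ 2 * 3)%N).
  + exact: ball_solution udg.
  + move=> j jJ; rewrite /M leq_mul2r leq_exp2r //=; lia.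
  + exact: ball_bound_lt_growth.
- exact: charged_step.
have [Lliar Lsize] := charged_end eps0 end_.
exists t, L; split=> //; last by rewrite -cLopt.
move=> n1; apply: leq_trans tw _; rewrite (maxn_idPl n1) leq_pexp2l ?(ltnW n1) //.
rewrite /M.
have : ((4 * (10 * J.+1 + 4)).+1 ^ 2 <= (2 ^ 6 * J.+1) ^ 2)%N by rewrite leq_exp2r //; lia.
rewrite expnMn -expnM -[(6 * 2)%N]/12%N -mulnA.
have : (J.+1 <= J.+1 ^ 2)%N by rewrite -mulnn leq_pmull.
have : (2 ^ 5 <= 2 ^ 12)%N by rewrite leq_exp2l.
by move: (J.+1 ^ 2)%N (2 ^ 12)%N (_ ^ 2)%N => x P y; nia.
Qed.
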